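(* Let $(\Omega,\mathcal{F},P)$ be a probability space, let $(B,\|\cdot\|)$ be a Banach space over $K$ (where $K=\mathbb{R}$ or $K=\mathbb{C}$), and let $V$ be a weakly compact convex subset of $B$ such that $V$ has normal structure. Then for every strong random nonexpansive operator $T:\Omega\times V\to V$ there exists a strong $\mathcal{F}$-random element $x^0:\Omega\to V$ such that $T(\omega,x^0(\omega))=x^0(\omega)$ for $P$-almost all $\omega\in\Omega$.
   Context: Random elements: for a metric space $M$, a map $X:\Omega\to M$ is an $\mathcal{F}$-random element if $X^{-1}(G)\in\mathcal{F}$ for every open $G\subset M$; it is simple if in addition it takes only finitely many values; it is a strong $\mathcal{F}$-random element if it is the pointwise limit of a sequence of simple random elements (equivalently, it is a random element with separable range). A map $T:\Omega\times V\to V$ is a strong random operator if $T(\cdot,v):\Omega\to V$ is a strong $\mathcal{F}$-random element for each $v\in V$. It is nonexpansive if for each $\omega\in\Omega$, $\|T(\omega,v_1)-T(\omega,v_2)\|\le\|v_1-v_2\|$ for all $v_1,v_2\in V$. A strong random nonexpansive operator is a strong random operator that is nonexpansive. Normal structure: a nonempty closed convex subset $V$ of $B$ has normal structure if for each bounded closed convex subset $H$ of $V$ with $\mathrm{Diam}(H):=\sup\{\|h_1-h_2\|:h_1,h_2\in H\}>0$ there exists $h_0\in H$ such that $\sup\{\|h_0-h\|:h\in H\}<\mathrm{Diam}(H)$. *)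

(* Defs.v *)
From HB Require Import structures.
From mathcomp Require Import all_boot all_order all_algebra.
From mathcomp Require Import all_classical all_reals all_analysis.
From mathcomp Require Import complex.

Set Implicit Arguments.
Unset Strict Implicit.
Unset Printing Implicit Defensive.

Import Order.TTheory GRing.Theory Num.Theory.
Import numFieldNormedType.Exports.

Local Open Scope classical_set_scope.
Local Open Scope ring_scope.

(* The field K, which is R or C = R[i]. *)
Variant scalars := RealScalars | ComplexScalars.

Definition scalar_field (R : realType) (k : scalars) : numFieldType :=
  match k with
  | RealScalars => R
  | ComplexScalars => R[i]
  end.

Definition scalar_Re (R : realType) (k : scalars) : scalar_field R k -> R :=
  match k with
  | RealScalars => fun a => a
  | ComplexScalars => fun a => complex.Re a
  end.

(* The norm of a normed space over K takes values in K, where suprema are not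
   available when K = C; norms are real, so taking real parts loses nothing. *)
Definition rnorm (R : realType) (k : scalars)
    (B : normedModType (scalar_field R k)) (x : B) : R :=
  scalar_Re `|x|.

Definition continuous_dual (K : numFieldType) (B : normedModType K) : Type :=
  {f : {linear B -> K^o} | continuous f}.

Definition weak (K : numFieldType) (B : normedModType K) : topologicalType :=
  sup_topology (fun f : continuous_dual B =>
    Topological.on (initial_topology (sval f : B -> K^o))).

Definition weakly_compact (K : numFieldType) (B : normedModType K)
    (V : set B) : Prop :=
  @compact (weak B) V.

(* `sup` is only meaningful on nonempty sets with an upper bound, so `diam` and
   `radius_at` are only meant for bounded H; sup set0 = 0, hence 0 < diam H
   excludes H = set0. *)
Definition diam (R : realType) (k : scalars)
    (B : normedModType (scalar_field R k)) (H : set B) : R :=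
  sup [set rnorm (h1 - h2) | h1 in H & h2 in H].

Definition radius_at (R : realType) (k : scalars)
    (B : normedModType (scalar_field R k)) (H : set B) (h0 : B) : R :=
  sup [set rnorm (h0 - h) | h in H].

Definition normal_structure (R : realType) (k : scalars)
    (B : normedModType (scalar_field R k)) (V : set B) : Prop :=
  [/\ V !=set0, closed V, convex_set V &
      forall H : set B, H `<=` V ->
        bounded_set H -> closed H -> convex_set H -> 0 < diam H ->
        exists2 h0, H h0 & radius_at H h0 < diam H].

(* Only the topology of the metric space M matters here. A subset V of B is
   used as M through the type of its elements, with the induced topology. *)
Section RandomElements.
Context {d : measure_display} {Omega : measurableType d} {M : topologicalType}.

Definition random_element (X : Omega -> M) : Prop :=
  forall G : set M, open G -> measurable (X @^-1` G).

Definition simple_random_element (X : Omega -> M) : Prop :=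
  random_element X /\ finite_set (range X).

Definition strong_random_element (X : Omega -> M) : Prop :=
  exists2 S : nat -> Omega -> M,
    forall n, simple_random_element (S n) &
    forall w, S n w @[n --> \oo] --> X w.

End RandomElements.

Section RandomOperators.
Context {d : measure_display} {Omega : measurableType d}.
Context {K : numFieldType} {B : normedModType K} {V : set B}.

Definition strong_random_operator (T : Omega -> V -> V) : Prop :=
  forall v : V, strong_random_element (T ^~ v).

Definition nonexpansive (T : Omega -> V -> V) : Prop :=
  forall (w : Omega) (v1 v2 : V),
    `|set_val (T w v1) - set_val (T w v2)| <= `|set_val v1 - set_val v2|.

Definition strong_random_nonexpansive_operator (T : Omega -> V -> V) : Prop :=
  strong_random_operator T /\ nonexpansive T.

End RandomOperators.

(* Main.v *)
Require Import Defs.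
From HB Require Import structures.
From mathcomp Require Import all_boot all_order all_algebra.
From mathcomp Require Import all_classical all_reals all_analysis.
From mathcomp Require Import complex measurable_realfun ring lra.

(* Kirk's fixed point theorem made measurable without measurable selections.
   [V] is replaced by a separable closed convex subset invariant under every
   [T w]. A closed-convex-valued multifunction [C] is measurable when the events
   "[C w] meets the closed ball [B(x, r)]" are; their probabilities, for [x] in a
   dense sequence and [r = 1/(j+1)], are countably many monotone functionals of
   [C] which determine [C] up to a null set. Since weak compactness allows
   decreasing sequences to be intersected, the Brezis-Browder principle yields
   an invariant measurable multifunction [G] that is minimal up to null sets.
   Then [G w] is contained in the intersection of the balls containing
   [T w (G w)], so the Chebyshev centre of [G w] is invariant and equals [G w];
   normal structure forces [G w] to be a single point, almost surely.
   Weak compactness enters through the Hahn-Banach theorem (closed convex sets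
   are weakly closed, weakly compact sets are bounded), which is proved for the
   underlying real vector space by minimizing sublinear functionals. *)

Set Implicit Arguments.
Unset Strict Implicit.
Unset Printing Implicit Defensive.

Import Order.TTheory GRing.Theory Num.Theory.
Import numFieldNormedType.Exports.

Local Open Scope classical_set_scope.
Local Open Scope ring_scope.

(** * Kirk's argument for measurable multifunctions *)

Section Exhaustion.
Context {R : realType} {X : Type} (le : X -> X -> Prop).
Hypothesis leX_refl : forall x, le x x.
Hypothesis leX_trans : forall x y z, le x y -> le y z -> le x z.
Hypothesis le_seq : forall u : nat -> X, (forall n, le (u n.+1) (u n)) ->
  exists x, forall n, le x (u n).

Let le_seq_from (step : nat -> X -> X) (x0 : X) :
  (forall n x, le (step n x) x) ->
  exists u : nat -> X, [/\ u 0%N = x0, forall n, u n.+1 = step n (u n) &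
    exists2 x, le x x0 & forall n, le x (u n)].
Proof.
move=> step_le.
pose u := fix u n := if n is m.+1 then step m (u m) else x0.
have [x xu] := le_seq (fun n => step_le n (u n) : le (u n.+1) (u n)).
by exists u; split => //; exists x => //; exact: (xu 0%N).
Qed.

(** A Baire-type argument: descend to a witness of [Q 0], then of [Q 1], and so on. A lower bound of
    this sequence inherits every [Q n], since each is hereditary downwards. *)
Lemma le_forall_dense (Q : nat -> X -> Prop) :
  (forall n x y, le y x -> Q n x -> Q n y) ->
  (forall n x, exists2 y, le y x & Q n y) ->
  forall x, exists2 y, le y x & forall n, Q n y.
Proof.
move=> Qle Qdense x0.
have /choice[step stepP] : forall nx : nat * X, exists y, le y nx.2 /\ Q nx.1 y.
  by move=> [n x]; have [y] := Qdense n x; exists y.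
have [|u [_ uS [x xx0 xu]]] := le_seq_from (step := fun n x => step (n, x)) x0.
  by move=> n x; have [] := stepP (n, x).
exists x => // n; apply: Qle (xu n.+1) _.
by rewrite uS; have [] := stepP (n, u n).
Qed.

(* The Brezis-Browder ordering principle. *)
Lemma le_minimum_dense (phi : X -> R) :
  (forall x, 0 <= phi x) -> (forall x y, le y x -> phi y <= phi x) ->
  forall x, exists2 y, le y x & forall z, le z y -> phi z = phi y.
Proof.
move=> phi0 phile x0.
pose E x := [set phi z | z in [set z | le z x]].
have E0 x : has_inf (E x).
  split; first by exists (phi x), x.
  by exists 0 => _ [z _ <-].
(* Step [n] comes within [1/(n+1)] of the infimum of [phi] below the current point, so below the
   lower bound of the sequence [phi] cannot drop by as much as any [1/(n+1)]. *)
have /choice[step stepP] : forall nx : nat * X,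
    exists y, le y nx.2 /\ phi y < inf (E nx.2) + nx.1.+1%:R^-1.
  move=> [n x]; have e0 : (0 : R) < n.+1%:R^-1 by rewrite invr_gt0.
  by have [_ [z zx <-] h] := inf_adherent e0 (E0 x); exists z.
have [|u [_ uS [x xx0 xu]]] := le_seq_from (step := fun n x => step (n, x)) x0.
  by move=> n x; have [] := stepP (n, x).
exists x => // z zx; apply/eqP; rewrite eq_le phile//=.
rewrite leNgt; apply/negP => /ltr_add_invr[n].
apply/negP; rewrite -leNgt; apply: (le_trans (phile _ _ (xu n.+1))).
have [_ /ltW] := stepP (n, u n); rewrite -uS => /le_trans; apply.
rewrite lerD2r; apply: ge_inf; first by have [] := E0 (u n).
by exists z => //=; apply: leX_trans zx _.
Qed.

End Exhaustion.

(** * Measurability of countably quantified events *)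

Section MeasurablePredicates.
Context {d : measure_display} {Omega : measurableType d}.

Lemma measurable_forall (A : nat -> set Omega) :
  (forall n, measurable (A n)) -> measurable [set w | forall n, A n w].
Proof.
move=> mA; rewrite (_ : [set _ | _] = \bigcap_n A n); first exact: bigcapT_measurable.
by apply/seteqP; split=> [w Aw n _|w Aw n]; exact: Aw.
Qed.

Lemma measurable_exists (A : nat -> set Omega) :
  (forall n, measurable (A n)) -> measurable [set w | exists n, A n w].
Proof.
move=> mA; rewrite (_ : [set _ | _] = \bigcup_n A n); first exact: bigcupT_measurable.
by apply/seteqP; split=> [w [n An]|w [n _ An]]; exists n.
Qed.

Lemma measurable_prop (Q : Prop) : measurable [set _ : Omega | Q].
Proof.
have [q|nq] := pselect Q.
  by rewrite (_ : [set _ | _] = setT)//; apply/seteqP; split.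
by rewrite (_ : [set _ | _] = set0)//; apply/seteqP; split.
Qed.

Lemma measurable_fun_geP {R : realType} (f : Omega -> R) :
  (forall c, measurable [set w | c <= f w]) -> measurable_fun setT f.
Proof.
move=> mf _; apply: (measurability _ (RGenCInfty.measurableE R)) => //.
move=> _ [_ [c ->] <-]; rewrite setTI.
rewrite (_ : _ @^-1` _ = [set w | c <= f w]) //.
by apply/seteqP; split=> w /=; rewrite in_itv/= andbT.
Qed.

Lemma measurable_ge {R : realType} (f : Omega -> R) c :
  measurable_fun setT f -> measurable [set w | c <= f w].
Proof.
move=> mf; rewrite (_ : [set _ | _] = setT `&` f @^-1` `[c, +oo[%classic).
  by apply: mf => //; exact: measurable_itv.
by rewrite setTI; apply/seteqP; split=> w /=; rewrite in_itv/= andbT.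
Qed.

End MeasurablePredicates.

(* [adm] stands for "closed and convex"; only the closure properties below matter. *)
Section MetricMultifunctions.
Context {R : realType} {M : Type} (dist : M -> M -> R) (bnd : R).
Context (adm : set M -> Prop) (v : nat -> M).
Hypothesis distxx : forall x, dist x x = 0.
Hypothesis dist_eq0 : forall x y, dist x y <= 0 -> x = y.
Hypothesis dist_sym : forall x y, dist x y = dist y x.
Hypothesis dist_tri : forall x y z, dist x z <= dist x y + dist y z.
Hypothesis dist_bnd : forall x y, dist x y <= bnd.
Hypothesis v_dense : forall x (e : R), 0 < e -> exists n, dist x (v n) < e.
Hypothesis adm_cball : forall x r, adm [set y | dist x y <= r].
Hypothesis adm_cap : forall (I : Type) (K : I -> set M),
  (forall i, adm (K i)) -> adm [set x | forall i, K i x].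
Hypothesis adm_compact : forall K : nat -> set M, (forall m, adm (K m)) ->
  (forall m, K m.+1 `<=` K m) -> (forall m, K m !=set0) ->
  exists x, forall m, K m x.

Lemma dist_ge0 x y : 0 <= dist x y.
Proof. by have := dist_tri x y x; rewrite distxx (dist_sym y x); lra. Qed.

Lemma v_dense_nat x m : exists n, dist x (v n) <= m.+1%:R^-1.
Proof.
have e0 : (0 : R) < m.+1%:R^-1 by rewrite invr_gt0.
by have [n /ltW] := v_dense x e0; exists n.
Qed.

Lemma adm_setI K L : adm K -> adm L -> adm (K `&` L).
Proof.
move=> aK aL; rewrite (_ : K `&` L = [set x | forall b : bool, (if b then K else L) x]).
  by apply: adm_cap => -[].
by apply/seteqP; split=> [x [Kx Lx] []//|x KL]; split; [exact: (KL true)|exact: (KL false)].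
Qed.

(** Enlarging all radii by [1/(m+1)] gives a decreasing sequence of nonempty admissible sets, and a
    common point satisfies the exact inequalities. Existence proofs below thus reduce to finding
    approximate solutions. *)
Lemma adm_balls_compact K (I : Type) (c : I -> M) (rho : I -> R) : adm K ->
  (forall e, 0 < e -> exists2 y, K y & forall i, dist (c i) y <= rho i + e) ->
  exists2 y, K y & forall i, dist (c i) y <= rho i.
Proof.
move=> aK Ke.
pose L m := K `&` [set y | forall i, dist (c i) y <= rho i + m.+1%:R^-1].
have [m|m|m|y Ly] := @adm_compact L.
- by apply: adm_setI => //; apply: adm_cap => i; exact: adm_cball.
- move=> y [Ky Ly]; split=> // i; apply: le_trans (Ly i) _.
  by rewrite lerD2l lef_pV2 ?posrE// ler_nat.
- have e0 : (0 : R) < m.+1%:R^-1 by rewrite invr_gt0.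
  by have [y Ky yP] := Ke _ e0; exists y.
exists y => [|i]; first by have [] := Ly 0%N.
rewrite leNgt; apply/negP => /ltr_add_invr[m]; apply/negP; rewrite -leNgt.
by have [_ /(_ i)] := Ly m.
Qed.

(* The infimum of the empty set is [0], so [setdist set0 x = 0]. *)
Definition setdist (C : set M) x : R := inf [set dist x y | y in C].

Lemma setdist_le C x y : C y -> setdist C x <= dist x y.
Proof.
move=> Cy; apply: ge_inf; last by exists y.
by exists 0 => _ [z _ <-]; exact: dist_ge0.
Qed.

Lemma le_setdist C x c : C !=set0 -> (forall y, C y -> c <= dist x y) ->
  c <= setdist C x.
Proof.
move=> [y Cy] h; apply: lb_le_inf; first by exists (dist x y), y.
by move=> _ [z Cz <-]; exact: h.
Qed.

Lemma ball_setdistP C y c : C !=set0 ->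
  (forall n, dist (v n) y <= c + setdist C (v n)) <->
  (forall z, C z -> dist y z <= c).
Proof.
move=> C0; split=> [h z Cz|h n].
  apply/ler_addgt0Pl => e e0.
  have [|n vn] := v_dense z (e := e / 2); first by rewrite divr_gt0.
  have := h n; have := setdist_le (v n) Cz; have := dist_tri y (v n) z.
  by rewrite (dist_sym y (v n)) (dist_sym z (v n)) in vn *; lra.
rewrite -lerBlDl; apply: le_setdist => // z Cz.
by have := h _ Cz; have := dist_tri (v n) z y; rewrite (dist_sym z y); lra.
Qed.

(** * Measurability of multifunctions *)

Section Measurability.
Context {d : measure_display} {Omega : measurableType d}.
Implicit Types (C : Omega -> set M) (rho : nat -> Omega -> R).

Definition hit C x r : set Omega := [set w | exists2 y, C w y & dist x y <= r].

Definition hit_measurable C := forall x r, measurable (hit C x r).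

(** The form shared by both shrinkings in Kirk's argument: countably many balls with deterministic
    centres and random radii. *)
Definition restrict C rho w : set M :=
  C w `&` [set y | forall n, dist (v n) y <= rho n w].

Lemma adm_restrict C rho w : adm (C w) -> adm (restrict C rho w).
Proof. by move=> aC; apply: adm_setI => //; apply: adm_cap => n; exact: adm_cball. Qed.

(** By compactness, if every set of a decreasing admissible sequence meets a closed ball, so does
    the intersection; the hitting event is therefore a countable intersection. *)
Lemma hit_measurable_cap (C : nat -> Omega -> set M) :
  (forall m w, adm (C m w)) -> (forall m w, C m.+1 w `<=` C m w) ->
  (forall m, hit_measurable (C m)) ->
  hit_measurable (fun w => [set x | forall m, C m w x]).
Proof.
move=> aC Cdec mC x r.
rewrite (_ : hit _ _ _ = [set w | forall m, hit (C m) x r w]).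
  by apply: measurable_forall => m; exact: mC.
apply/seteqP; split=> [w [y Cy xy] m|w h]; first by exists y.
have [m|m|m|y Ly] := @adm_compact (fun m => C m w `&` [set y | dist x y <= r]).
- exact: adm_setI.
- by move=> y [/Cdec].
- by have [y Cy xy] := h m; exists y.
by exists y; [move=> m; have [] := Ly m | have [] := Ly 0%N].
Qed.

(** Hitting is tested on the dense sequence: for each [m], some [v k] within [1/(m+1)] of a point of
    [C w] satisfies all ball constraints up to [1/(m+1)]. Conversely, such [v k] yield approximate
    solutions in [C w], and [adm_balls_compact] makes them exact. *)
Lemma hit_measurable_restrict C rho : (forall w, adm (C w)) ->
  hit_measurable C -> (forall n, measurable_fun setT (rho n)) ->
  hit_measurable (restrict C rho).
Proof.
move=> aC mC mrho x r.
rewrite (_ : hit _ _ _ = [set w | forall m, exists k,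
    (hit C (v k) m.+1%:R^-1 `&` [set _ | dist x (v k) <= r + m.+1%:R^-1] `&`
    [set w | forall n, dist (v k) (v n) - m.+1%:R^-1 <= rho n w]) w]).
  apply: measurable_forall => m; apply: measurable_exists => k.
  apply: measurableI; first by apply: measurableI => //; exact: measurable_prop.
  by apply: measurable_forall => n; exact: measurable_ge.
apply/seteqP; split=> [w [y [Cy yrho] xy] m|w h].
  have [k] := v_dense_nat y m; move: m.+1%:R^-1 => e yk; exists k; split; first split.
  - by exists y => //; rewrite dist_sym.
  - by have := dist_tri x y (v k) => /=; lra.
  move=> n /=; have := yrho n; have := dist_tri (v k) y (v n).
  by rewrite (dist_sym (v k) y) (dist_sym y (v n)); lra.
(* The ball about [x] is adjoined under the index [None], so that a single compactness argument
   handles all constraints. *)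
pose c (i : option nat) := if i is Some n then v n else x.
pose s (i : option nat) := if i is Some n then rho n w else r.
have [//|e e0|y Cy yP] := @adm_balls_compact (C w) _ c s.
  have [m] := ltr_add_invr (divr_gt0 e0 (ltr0Sn R 1)); rewrite add0r => me.
  have [k [[[y Cy]]]] := h m; move: m.+1%:R^-1 me => e' me ky /= xk nk.
  exists y => // -[n|] /=; last by have := dist_tri x (v k) y; lra.
  have := nk n; have := dist_tri (v n) (v k) y.
  by rewrite (dist_sym (v n) (v k)); lra.
by exists y => //; [split=> // n; exact: (yP (Some n)) | exact: (yP None)].
Qed.

Lemma hit_measurable_if C C' (N : set Omega) : measurable N ->
  hit_measurable C -> hit_measurable C' ->
  hit_measurable (fun w => if pselect (N w) then C w else C' w).
Proof.
move=> mN mC mC' x r.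
rewrite (_ : hit _ _ _ = (N `&` hit C x r) `|` (~` N `&` hit C' x r)).
  by apply: measurableU; apply: measurableI => //; exact: measurableC.
apply/seteqP; split=> w; rewrite /hit /=.
  by case: pselect => Nw [y Cy xy]; [left|right]; split=> //; exists y.
by move=> [] [Nw [y Cy xy]]; exists y => //; case: pselect.
Qed.

Lemma measurable_setdist C x : (forall w, C w !=set0) -> hit_measurable C ->
  measurable_fun setT (fun w => setdist (C w) x).
Proof.
move=> C0 mC; apply: measurable_fun_geP => c.
rewrite (_ : [set _ | _] = ~` [set w | exists m, hit C x (c - m.+1%:R^-1) w]).
  by apply: measurableC; apply: measurable_exists.
apply/seteqP; split=> [w /= cle [m [y Cy]]|w h /=].
  have : 0 < m.+1%:R^-1 :> R by rewrite invr_gt0.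
  by move: m.+1%:R^-1 => e; have := setdist_le x Cy; lra.
apply: le_setdist => // y Cy; rewrite leNgt; apply/negP => /ltr_add_invr[m lt_c].
by apply: h; exists m, y => //; rewrite lerBrDr ltW.
Qed.

(** The Chebyshev radius of [K], with centres restricted to [K] itself. *)
Definition radius (K : set M) : R :=
  inf [set c | exists2 y, K y & forall z, K z -> dist y z <= c].

Lemma radius_has_inf K : K !=set0 ->
  has_inf [set c | exists2 y, K y & forall z, K z -> dist y z <= c].
Proof.
move=> [x Kx]; split; first by exists bnd, x.
by exists 0 => c [y Ky /(_ _ Ky)]; rewrite distxx.
Qed.

Lemma radius_le (K : set M) y c : K y -> (forall z, K z -> dist y z <= c) ->
  radius K <= c.
Proof.
move=> Ky yc; apply: ge_inf; last by exists y.
by have [] := radius_has_inf (ex_intro _ y Ky).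
Qed.

(** Approximate centres exist by definition of the infimum; [ball_setdistP] writes the centre
    condition as ball constraints, to which compactness applies. *)
Lemma radius_attained K c : adm K -> K !=set0 -> radius K <= c ->
  exists2 y, K y & forall z, K z -> dist y z <= c.
Proof.
move=> aK K0 rc.
have [//|e e0|y Ky yP] :=
    @adm_balls_compact K _ v (fun n => c + setdist K (v n)).
  have [c' [y Ky yc'] c'r] := inf_adherent e0 (radius_has_inf K0).
  exists y => // n; rewrite addrAC.
  apply: (ball_setdistP y (c + e) K0).2 => z Kz.
  by apply: le_trans (yc' z Kz) _; rewrite -/(radius K) in c'r; lra.
by exists y => //; apply/ball_setdistP.
Qed.

Lemma measurable_radius C : (forall w, adm (C w)) -> (forall w, C w !=set0) ->
  hit_measurable C -> measurable_fun setT (fun w => radius (C w)).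
Proof.
move=> aC C0 mC; apply: measurable_fun_geP => c.
pose C' m := restrict C (fun n w => c - m.+1%:R^-1 + setdist (C w) (v n)).
(* The ball of radius [bnd] about [v 0] is the whole space, so hitting it means that [C' m w] is
   nonempty, that is, that some point of [C w] is a centre for the radius [c - 1/(m+1)]. *)
rewrite (_ : [set _ | _] = ~` [set w | exists m, hit (C' m) (v 0%N) bnd w]).
  apply: measurableC; apply: measurable_exists => m.
  apply: hit_measurable_restrict => // n.
  by apply: measurable_funD => //; exact: measurable_setdist.
apply/seteqP; split=> [w /= cle [m [y [Cy /ball_setdistP yc] _]]|w h /=].
  have : 0 < m.+1%:R^-1 :> R by rewrite invr_gt0.
  by have := radius_le Cy (yc (C0 w)); move: m.+1%:R^-1 => e; lra.
rewrite leNgt; apply/negP => /ltr_add_invr[m /ltW]; rewrite -lerBrDr => lt_c.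
have [y Cy yc] := radius_attained (aC w) (C0 w) lt_c.
by apply: h; exists m, y => //; split=> //; apply/ball_setdistP.
Qed.

(** * Minimal invariant multifunctions and the random fixed point *)

Context (P : probability Omega R) (T : Omega -> M -> M).
Hypothesis T_nonexp : forall w x y, dist (T w x) (T w y) <= dist x y.
Hypothesis T_meas : forall x y c, measurable [set w | dist y (T w x) <= c].
(** Normal structure without suprema: [c] bounds the distances from [h] and is exceeded by the
    distance of some pair in [K]. *)
Hypothesis adm_normal : forall K x y, adm K -> K x -> K y -> x <> y ->
  exists c, (exists2 h, K h & forall z, K z -> dist h z <= c) /\
    exists a b, [/\ K a, K b & c < dist a b].

Definition invariant C :=
  [/\ forall w, adm (C w), forall w, C w !=set0, hit_measurable C &
      forall w x, C w x -> C w (T w x)].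

Lemma le_probability (A B : set Omega) : measurable A -> measurable B ->
  A `<=` B -> fine (P A) <= fine (P B).
Proof.
move=> mA mB AB; apply: fine_le; [exact: fin_num_measure..|].
by apply: le_measure => //; rewrite inE.
Qed.

(** Every hitting probability [phi n j] is made minimal below [G]. For an invariant [C] inside [G]
    the nested hitting events then have equal probability, so they differ by null sets. Outside
    their countable union [C w] and [G w] meet the same small balls, hence coincide. *)
Lemma ae_minimal_invariant : exists2 G, invariant G &
  forall C, invariant C -> (forall w, C w `<=` G w) ->
    exists N, [/\ measurable N, P N = 0%E & forall w, ~ N w -> G w `<=` C w].
Proof.
pose X := {C | invariant C}.
pose le (C C' : X) := forall w, sval C w `<=` sval C' w.
have lexx (C : X) : le C C by move=> w.
have le_tr (A B C : X) : le A B -> le B C -> le A C.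
  by move=> AB BC w; exact: subset_trans (AB w) (BC w).
have le_seq (u : nat -> X) : (forall n, le (u n.+1) (u n)) ->
    exists C : X, forall n, le C (u n).
  move=> udec.
  have ua n w : adm (sval (u n) w) by have [] := svalP (u n).
  suff inv : invariant (fun w => [set x | forall n, sval (u n) w x]).
    by exists (exist _ _ inv) => n w x; apply.
  split=> [w|w||w x Cx n].
  - exact: adm_cap.
  - have [//|m||x ux] := @adm_compact (fun n => sval (u n) w).
    + exact: udec.
    + by move=> m; have [] := svalP (u m).
    + by exists x.
  - by apply: hit_measurable_cap => // m; have [] := svalP (u m).
  - by have [_ _ _] := svalP (u n); apply; exact: Cx.
pose phi n j (C : X) := fine (P (hit (sval C) (v n) j.+1%:R^-1)).
have mhit (C : X) x r : measurable (hit (sval C) x r) by have [_ _ mC _] := svalP C.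
have phile n j (C C' : X) : le C' C -> phi n j C' <= phi n j C.
  move=> C'C; apply: le_probability => // w [y C'y vy].
  by exists y => //; exact: C'C.
have dense n j (C : X) :
    exists2 C' : X, le C' C & forall D, le D C' -> phi n j D = phi n j C'.
  apply: le_minimum_dense => //; last exact: phile.
  by move=> D; rewrite fine_ge0.
have her n j (x y : X) : le y x -> (forall D, le D x -> phi n j D = phi n j x) ->
    forall D, le D y -> phi n j D = phi n j y.
  by move=> yx h D Dy; rewrite h ?(h y)//; exact: le_tr Dy yx.
(* Minimality of [phi n j] is hereditary by [her]; [le_forall_dense] collects it first over [j],
   then over [n]. *)
have dense' n (C : X) : exists2 C' : X, le C' C &
    forall j (D : X), le D C' -> phi n j D = phi n j C'.
  apply: (le_forall_dense le_seq (Q := fun j (C' : X) =>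
    forall D, le D C' -> phi n j D = phi n j C')); first exact: her.
  exact: dense.
have invT : invariant (fun=> setT).
  split=> // [w|w|x r].
  (* The whole space is admissible as an intersection over an empty index type. *)
  - rewrite (_ : setT = [set x | forall i : False, [set: M] x]); first exact: adm_cap.
    by apply/seteqP; split.
  - by exists (v 0%N).
  - rewrite (_ : hit _ _ _ = [set _ | exists2 y, setT y & dist x y <= r]) //.
    exact: measurable_prop.
have [G _ Gmin] : exists2 G, le G (exist _ _ invT) &
    forall n j D, le D G -> phi n j D = phi n j G.
  apply: (le_forall_dense le_seq (Q := fun n (C' : X) =>
    forall j (D : X), le D C' -> phi n j D = phi n j C')) => //.
  by move=> n x y yx h j; exact: her yx (h j).
exists (sval G); first exact: svalP.
move=> C invC CG; pose N n j := hit (sval G) (v n) j.+1%:R^-1 `\` hit C (v n) j.+1%:R^-1.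
have [aC C0 mC _] := invC.
have mN n j : measurable (N n j) by exact: measurableD.
exists (\bigcup_n \bigcup_j N n j); split.
- by apply: bigcupT_measurable => n; exact: bigcupT_measurable.
- apply/eqP; rewrite eq_le measure_ge0 andbT.
  have N0 n j : P (N n j) = 0%E.
    have hC : hit C (v n) j.+1%:R^-1 `<=` hit (sval G) (v n) j.+1%:R^-1.
      by move=> w [y Cy vy]; exists y => //; exact: CG.
    rewrite /N measureD//; last by rewrite ltey_eq fin_num_measure.
    rewrite setIidr//.
    have : P (hit C (v n) j.+1%:R^-1) = P (hit (sval G) (v n) j.+1%:R^-1).
      rewrite -[LHS]fineK ?fin_num_measure// -[RHS]fineK ?fin_num_measure//.
      by congr EFin; exact: (Gmin n j (exist _ C invC) CG).
    by move=> /= ->; rewrite subee// fin_num_measure.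
  have : P.-negligible (\bigcup_n \bigcup_j N n j).
    apply: negligible_bigcup => n; apply: negligible_bigcup => j.
    by exists (N n j); split=> //; exact: N0.
  move=> /measure_negligible ->//.
  by apply: bigcupT_measurable => n; exact: bigcupT_measurable.
move=> w nN x Gx.
(* A one-ball family of radius [0] about [x]: it suffices to find points of [C w] arbitrarily close
   to [x]. *)
have [//|e e0|y Cy /(_ tt) /dist_eq0 ->//] :=
    @adm_balls_compact (C w) unit (fun=> x) (fun=> 0).
have [m] := ltr_add_invr (divr_gt0 e0 (ltr0Sn R 1)); rewrite add0r => me.
have [n xn] := v_dense_nat x m.
have [y Cy vy] : hit C (v n) m.+1%:R^-1 w.
  apply: contrapT => nC; apply: nN; exists n => //; exists m => //; split=> //.
  by exists x => //; rewrite dist_sym.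
exists y => // _; have := dist_tri x (v n) y.
by move: m.+1%:R^-1 me xn vy => e'; lra.
Qed.

(** For nonempty [C w], the radius of the smallest closed ball about [v n] containing
    [T w (C w)]. *)
Let image_radius C n w : R := sup [set dist (v n) (T w z) | z in C w].

Let image_radius_ge C n w z : C w z -> dist (v n) (T w z) <= image_radius C n w.
Proof.
move=> Cz; apply: ub_le_sup; last by exists z.
by exists bnd => _ [y _ <-].
Qed.

Let image_radius_le C n w c : C w !=set0 ->
  (forall z, C w z -> dist (v n) (T w z) <= c) -> image_radius C n w <= c.
Proof.
move=> [z Cz] h; apply: ge_sup; first by exists (dist (v n) (T w z)), z.
by move=> _ [y Cy <-]; exact: h.
Qed.

(** Measurability of [T] is given at fixed points only, so [T w] is evaluated at points [v k] close
    to [C w]; nonexpansiveness controls the error. *)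
Let measurable_image_radius C n : (forall w, C w !=set0) -> hit_measurable C ->
  measurable_fun setT (image_radius C n).
Proof.
move=> C0 mC; apply: measurable_fun_geP => c.
(* The slack [2/(m+1)] pays once for approximating the supremum and once for replacing a point of
   [C w] by [v k]. *)
rewrite (_ : [set _ | _] = [set w | forall m, exists k,
    (hit C (v k) m.+1%:R^-1 `&`
     ~` [set w | dist (v n) (T w (v k)) <= c - m.+1%:R^-1 *+ 2]) w]).
  apply: measurable_forall => m; apply: measurable_exists => k.
  by apply: measurableI => //; exact: measurableC.
apply/seteqP; split=> [w /= cs m|w h /=].
  have : 0 < m.+1%:R^-1 :> R by rewrite invr_gt0.
  move: (v_dense_nat ^~ m); move: m.+1%:R^-1 => e vdense e0.
  have [z Cz zs] : exists2 z, C w z & c - e < dist (v n) (T w z).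
    apply: contrapT => nz; suff : image_radius C n w <= c - e by lra.
    apply: image_radius_le => // z Cz; rewrite leNgt; apply/negP => lt.
    by apply: nz; exists z.
  have [k zk] := vdense z; exists k; split.
    by exists z => //; rewrite dist_sym.
  have := T_nonexp w (v k) z; have := dist_tri (v n) (T w (v k)) (T w z).
  by rewrite /= (dist_sym (v k)) mulr2n; lra.
apply/ler_addgt0Pl => e e0.
have [m] := ltr_add_invr (divr_gt0 e0 (ltr0Sn R 2)); rewrite add0r => me.
have [k [[z Cz kz] /negP]] := h m; rewrite -ltNge.
have := image_radius_ge n Cz.
have := T_nonexp w z (v k); have := dist_tri (v n) (T w z) (T w (v k)).
by move: m.+1%:R^-1 me kz => e' me; rewrite (dist_sym z) mulr2n; lra.
Qed.

(* Kirk's argument, with the closed convex hull of [T w (G w)] replaced by the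
   intersection of the balls containing it. *)
Lemma random_kirk_metric : exists x0 : Omega -> M,
  (forall y r, measurable [set w | dist y (x0 w) <= r]) /\
  exists N, [/\ measurable N, P N = 0%E & forall w, ~ N w -> T w (x0 w) = x0 w].
Proof.
have [G [aG G0 mG TG] Gmin] := ae_minimal_invariant.
(* First use of minimality: cutting [G w] by the balls containing [T w (G w)] keeps it invariant. *)
have [N1 [mN1 PN1 GN1]] : exists N, [/\ measurable N, P N = 0%E &
    forall w, ~ N w -> G w `<=` restrict G (image_radius G) w].
  apply: Gmin => [|w x []//]; split=> [w|w||w x [Gx _]].
  - exact: adm_restrict.
  - have [z Gz] := G0 w; exists (T w z); split; first exact: TG.
    by move=> n; exact: image_radius_ge.
  - by apply: hit_measurable_restrict => // n; exact: measurable_image_radius.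
  - by split; [exact: TG | move=> n; exact: image_radius_ge].
pose rho n w := radius (G w) + setdist (G w) (v n).
(* Off [N1] this is the Chebyshev centre of [G w]. Its invariance relies on [GN1], so [G] is left
   unchanged on [N1]. *)
pose C w := if pselect (N1 w) then G w else restrict G rho w.
have [N2 [mN2 PN2 GN2]] : exists N, [/\ measurable N, P N = 0%E &
    forall w, ~ N w -> G w `<=` C w].
  apply: Gmin; last by move=> w; rewrite /C; case: pselect => /= _ x // [].
  split=> [w|w||w x].
  - by rewrite /C; case: pselect => //= _; exact: adm_restrict.
  - rewrite /C; case: pselect => //= _.
    have [y Gy yP] := radius_attained (aG w) (G0 w) (lexx _).
    by exists y; split=> //; apply/ball_setdistP.
  - apply: hit_measurable_if => //; apply: hit_measurable_restrict => // n.
    by apply: measurable_funD; [exact: measurable_radius | exact: measurable_setdist].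
  - rewrite /C; case: pselect => /= [_|nN1]; first exact: TG.
    move=> [Gx /ball_setdistP xr]; split; first exact: TG.
    (* For a centre [x], the ball about [T w x] of radius [radius (G w)] contains [T w (G w)].
       Moving its centre to a nearby [v n] costs [e / 2]; by [GN1] the enlarged ball contains [G w],
       and moving back costs another [e / 2]. *)
    apply/ball_setdistP => // z Gz; apply/ler_addgt0Pl => e e0.
    have [|n vn] := v_dense (T w x) (e := e / 2); first by rewrite divr_gt0.
    have : image_radius G n w <= e / 2 + radius (G w).
      apply: image_radius_le => // u Gu.
      have := xr (G0 w) u Gu; have := T_nonexp w x u.
      by have := dist_tri (v n) (T w x) (T w u); rewrite (dist_sym (v n) (T w x)); lra.
    have [_ /(_ n)] := GN1 w nN1 z Gz.
    by have := dist_tri (T w x) (v n) z; lra.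
pose N := N1 `|` N2.
have mN : measurable N by exact: measurableU.
(* Off [N] every point of [G w] is a Chebyshev centre, so no two points are further apart than the
   radius; with two distinct points this contradicts normal structure. *)
have G1 w x y : ~ N w -> G w x -> G w y -> x = y.
  move=> nN Gx Gy; apply: contrapT => xy.
  have [c [[h Gh hc] [a [b [Ga Gb]]]]] := adm_normal (aG w) Gx Gy xy.
  apply/negP; rewrite -leNgt; apply: le_trans _ (radius_le Gh hc).
  have nN2 : ~ N2 w by move=> ?; apply: nN; right.
  move: (GN2 w nN2 a Ga); rewrite /C; case: pselect => /= [N1w|_].
    by case: nN; left.
  by move=> [_ /ball_setdistP]; apply.
have /choice[x0 x0P] : forall w, exists x, (if pselect (N w) then [set v 0%N] else G w) x.
  by move=> w; case: pselect => /= _; [exists (v 0%N)|exact: G0].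
exists x0; split=> [y r|].
  rewrite (_ : [set _ | _] =
      hit (fun w => if pselect (N w) then [set v 0%N] else G w) y r).
    apply: hit_measurable_if => // x r'.
    rewrite (_ : hit _ _ _ = [set _ | exists2 y, [set v 0%N] y & dist x y <= r']) //.
    exact: measurable_prop.
  apply/seteqP; split=> w; first by exists (x0 w) => //; exact: x0P.
  rewrite /hit /=; have := x0P w; case: pselect => /= nN; first by move=> -> [_ ->].
  by move=> Gx0 [x Gx]; rewrite (G1 _ _ _ nN Gx Gx0).
exists N; split=> //.
  by apply: measure_negligible => //; apply: negligibleU; [exists N1|exists N2]; split.
move=> w nN; have := x0P w; case: pselect => //= _ Gx.
exact: G1 nN (TG _ _ Gx) Gx.
Qed.

End Measurability.
End MetricMultifunctions.

(** * The Hahn-Banach theorem *)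

Section HahnBanach.
Context {R : realType} {E : lmodType R}.
Implicit Types (p q u : E -> R).

Definition sublinear q :=
  (forall x y, q (x + y) <= q x + q y) /\
  (forall t x, 0 <= t -> q (t *: x) = t * q x).

Lemma sublinearW q : (forall x y, q (x + y) <= q x + q y) -> q 0 = 0 ->
  (forall t x, 0 < t -> q (t *: x) <= t * q x) -> sublinear q.
Proof.
move=> qD q0 qZ; split=> // t x; rewrite le_eqVlt => /predU1P[<-|t0].
  by rewrite scale0r mul0r.
apply/eqP; rewrite eq_le qZ//= -ler_pdivlMl//.
have := qZ t^-1 (t *: x); rewrite invr_gt0 => /(_ t0).
by rewrite scalerA mulVf ?gt_eqF// scale1r.
Qed.

Lemma sublinear0 q : sublinear q -> q 0 = 0.
Proof. by move=> [_ qZ]; rewrite -(scale0r 0) qZ// mul0r. Qed.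

Lemma sublinear_geN q x : sublinear q -> - q (- x) <= q x.
Proof.
move=> sq; have [qD _] := sq.
by have := qD x (- x); rewrite subrr (sublinear0 sq); lra.
Qed.

(** Convexity with explicit real weights, matched with [convex_set] over either scalar field by
    [convex_combinationsP]. *)
Definition convex_combinations (D : set E) := forall x y s t, D x -> D y ->
  0 <= s -> 0 <= t -> s + t = 1 -> D (s *: x + t *: y).

(* The functional [p] is the infimum of the [q (z + t d) - t e] over [0 <= t]
   and [D d]. *)
Lemma sublinear_lower q (D : set E) e : sublinear q -> D !=set0 ->
  convex_combinations D -> (forall x, D x -> e <= q x) ->
  exists p, [/\ sublinear p, forall x, p x <= q x &
    forall x, D x -> p (- x) <= - e].
Proof.
move=> sq [d0 Dd0] cD eD; have [qD qZ] := sq.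
pose A z := [set r | exists t d, [/\ 0 <= t, D d & r = q (z + t *: d) - t * e]].
have A_ge z r : A z r -> - q (- z) <= r.
  move=> [t [d [t0 Dd ->]]].
  have := qD (- z) (z + t *: d); rewrite addKr qZ//.
  by have := ler_wpM2l t0 (eD _ Dd); lra.
have A_inf z : has_inf (A z).
  split; first by exists (q (z + 0 *: d0) - 0 * e), 0, d0.
  by exists (- q (- z)) => r /A_ge.
pose p z := inf (A z).
have p_le z t d : 0 <= t -> D d -> p z <= q (z + t *: d) - t * e.
  by move=> t0 Dd; apply: ge_inf; [have [] := A_inf z | exists t, d].
have le_p z c : (forall t d, 0 <= t -> D d -> c <= q (z + t *: d) - t * e) ->
    c <= p z.
  move=> h; apply: lb_le_inf; first by have [] := A_inf z.
  by move=> r [t [d [t0 Dd ->]]]; exact: h.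
have p_leq z : p z <= q z.
  by have := p_le z 0 d0 (lexx _) Dd0; rewrite scale0r addr0 mul0r subr0.
exists p; split=> //; last first.
  move=> d Dd; have := p_le (- d) 1 d ler01 Dd.
  by rewrite scale1r addNr (sublinear0 sq) mul1r sub0r.
apply: sublinearW => [x y||t x t0].
- suff h s a t b : 0 <= s -> D a -> 0 <= t -> D b ->
      p (x + y) <= (q (x + s *: a) - s * e) + (q (y + t *: b) - t * e).
    rewrite -lerBlDr; apply: (le_p) => s a s0 Da.
    rewrite lerBlDr -lerBlDl; apply: (le_p) => t b t0 Db.
    by rewrite lerBlDl; exact: h.
  move=> s0 Da t0 Db.
  have : 0 <= s + t by rewrite addr_ge0.
  rewrite le_eqVlt => /predU1P[st0|st0].
    have [-> ->] : s = 0 /\ t = 0 by split; lra.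
    rewrite !scale0r !mul0r !addr0 !subr0.
    exact: le_trans (p_leq _) (qD _ _).
  have st0' : s + t != 0 by rewrite gt_eqF.
  (* The candidates [s a] and [t b] add up to [s + t] times this convex combination. *)
  have Dc : D ((s / (s + t)) *: a + (t / (s + t)) *: b).
    by apply: cD => //; rewrite ?divr_ge0 ?addr_ge0// -mulrDl divff.
  apply: le_trans (p_le _ _ _ (ltW st0) Dc) _.
  rewrite scalerDr !scalerA !(mulrC (s + t) (_ / _)) !divfK// addrACA.
  by have := qD (x + s *: a) (y + t *: b); lra.
- apply/eqP; rewrite eq_le -{1}(sublinear0 sq) p_leq/=; apply: (le_p) => t d t0 Dd.
  by rewrite add0r qZ// -mulrBr mulr_ge0// subr_ge0 eD.
- rewrite -ler_pdivrMl//; apply: (le_p) => s d s0 Dd.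
  rewrite ler_pdivrMl//; have := p_le (t *: x) (t * s) d (mulr_ge0 (ltW t0) s0) Dd.
  by rewrite -scalerA -scalerDr qZ ?(ltW t0)// mulrBr mulrA.
Qed.

(** Zorn's lemma for the reversed pointwise order; the lower bound of a nonempty chain is its
    pointwise infimum. *)
Lemma minimal_sublinear q : sublinear q -> exists p, [/\ sublinear p,
  forall x, p x <= q x & forall p', sublinear p' -> (forall x, p' x <= p x) ->
    forall x, p' x = p x].
Proof.
move=> sq; have [qD qZ] := sq.
pose X := {p | sublinear p /\ forall x, p x <= q x}.
pose ge (a b : X) : bool := `[< forall x, sval b x <= sval a x >].
have sX (a : X) : sublinear (sval a) by have [] := svalP a.
have Xq (a : X) x : sval a x <= q x by have [] := svalP a.
have [|||[p [sp pq]] pmin] := @ZL_preorder X (exist _ q (conj sq (fun=> lexx _))) ge.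
- by move=> a; apply/asboolP.
- move=> b a c /asboolP ab /asboolP bc; apply/asboolP => x.
  exact: le_trans (bc x) (ab x).
- move=> A Atot; have [[a0 Aa0]|A0] := pselect (A !=set0); last first.
    exists (exist _ q (conj sq (fun=> lexx _))) => a Aa.
    by case: A0; exists a.
  pose V x := [set sval a x | a in A].
  have V_inf x : has_inf (V x).
    split; first by exists (sval a0 x), a0.
    exists (- q (- x)) => _ [a _ <-].
    apply: le_trans _ (sublinear_geN x (sX a)).
    by rewrite lerN2.
  pose p x := inf (V x).
  have p_le a x : A a -> p x <= sval a x.
    by move=> Aa; apply: ge_inf; [have [] := V_inf x | exists a].
  have le_p x c : (forall a, A a -> c <= sval a x) -> c <= p x.
    move=> h; apply: lb_le_inf; first by have [] := V_inf x.
    by move=> _ [a Aa <-]; exact: h.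
  have sp : sublinear p.
    apply: sublinearW => [x y||t x t0].
    + rewrite -lerBlDr; apply: (le_p) => a Aa; rewrite lerBlDr -lerBlDl.
      apply: (le_p) => b Ab; rewrite lerBlDl.
      (* The infimum is subadditive because the smaller of two functionals in the chain can serve
         for both summands. *)
      have [/asboolP ba|/asboolP ab] := Atot a b Aa Ab.
        apply: le_trans (p_le b _ Ab) _; have [bD _] := sX b.
        by apply: le_trans (bD x y) _; rewrite lerD2r.
      apply: le_trans (p_le a _ Aa) _; have [aD _] := sX a.
      by apply: le_trans (aD x y) _; rewrite lerD2l.
    + apply/eqP; rewrite eq_le; apply/andP; split.
        by rewrite -(sublinear0 (sX a0)); exact: p_le.
      by apply: (le_p) => a Aa; rewrite (sublinear0 (sX a)).
    + rewrite -ler_pdivrMl//; apply: (le_p) => a Aa; rewrite ler_pdivrMl//.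
      by have [_ aZ] := sX a; rewrite -aZ ?(ltW t0)//; exact: p_le.
  have pq x : p x <= q x by exact: le_trans (p_le a0 x Aa0) (Xq a0 x).
  exists (exist _ p (conj sp pq)) => a Aa; apply/asboolP => x.
  exact: p_le.
exists p; split=> // p' sp' p'p x; apply/eqP; rewrite eq_le p'p/=.
have p'q y : p' y <= q y by exact: le_trans (p'p y) (pq y).
have := pmin (exist _ p' (conj sp' p'q)).
by move=> /(_ (introT (asboolP _) p'p)) /asboolP; apply.
Qed.

(* A minimal sublinear functional [p] is linear: lowering it along [x] would
   otherwise decrease [p (- x)] to [- p x]. *)
Lemma hahn_banach q : sublinear q ->
  exists2 u, scalar u & forall x, u x <= q x.
Proof.
move=> /minimal_sublinear[u [su uq umin]]; exists u => //.
have uN x : u (- x) = - u x.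
  apply/eqP; rewrite eq_le; apply/andP; split; last first.
    by rewrite lerNl; exact: sublinear_geN.
  have [|y z s t -> -> _ _ st|y ->//|p [sp pu px]] :=
    @sublinear_lower u [set x] (u x) su; first by exists x.
    by rewrite -scalerDl st scale1r.
  by rewrite -(umin p)//; exact: px.
have uD x y : u (x + y) = u x + u y.
  apply/eqP; rewrite eq_le; have [h _] := su; rewrite h/=.
  by have := h (x + y) (- y); rewrite addrK uN; lra.
move=> a x y; rewrite uD; congr (_ + _); have [_ uZ] := su.
have [a0|a0] := leP 0 a; first exact: uZ.
by rewrite -[a]opprK scaleNr uN uZ ?mulNr// oppr_ge0 ltW.
Qed.

(** A linear [u] below the functional of [sublinear_lower] satisfies [- u x = u (- x) <= - e] on
    [D]. *)
Lemma mazur_orlicz q (D : set E) e : sublinear q -> D !=set0 ->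
  convex_combinations D -> (forall x, D x -> e <= q x) ->
  exists u, [/\ scalar u, forall x, u x <= q x & forall x, D x -> e <= u x].
Proof.
move=> sq D0 cD eD; have [p [sp pq pD]] := sublinear_lower sq D0 cD eD.
have [u lu up] := hahn_banach sp; exists u; split=> // x.
  exact: le_trans (up x) (pq x).
move=> Dx; have := le_trans (up (- x)) (pD x Dx).
have := lu (-1) x 0; have := lu 1 0 0.
by rewrite scale1r !addr0 scaleN1r; lra.
Qed.

End HahnBanach.

(** * The uniform boundedness principle *)

Section UniformBoundedness.
Context {R : realType} {E : lmodType R}.

Lemma le0_of_le_expn (r c : R) : (forall n, r <= 4^-1 ^+ n * c) -> r <= 0.
Proof.
move=> h; rewrite leNgt; apply/negP => r0.
have c0 : 0 < c by have := h 0%N; rewrite expr0 mul1r; exact: lt_le_trans.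
have [n] := ltr_add_invr (divr_gt0 r0 c0); rewrite add0r.
rewrite ltr_pdivlMr//; apply/negP; rewrite -leNgt.
apply: le_trans (h n) _; rewrite ler_wpM2r ?(ltW c0)//.
rewrite exprVn lef_pV2 ?posrE ?exprn_gt0//.
by rewrite -natrX ler_nat ltn_expl.
Qed.

(* The functional is [sum_i (+/-) 4^-i g_i], where [g_i] norms [x_i], [x_i] being
   a point of [A] of norm at least [4^i i], and where the signs prevent
   cancellations at [x_i]. *)
Lemma uniform_boundedness (N : E -> R) (A : set E) : sublinear N ->
  (forall x, N (- x) = N x) ->
  (forall u, scalar u -> (exists c, forall x, `|u x| <= c * N x) ->
    exists m, forall x, A x -> `|u x| <= m) ->
  exists m, forall x, A x -> N x <= m.
Proof.
move=> sN NN wbd; apply: contrapT => nbd.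
have N0 x : 0 <= N x by have := sublinear_geN x sN; rewrite NN; lra.
have /choice[x xP] n : exists x, A x /\ 4 ^+ n * n%:R <= N x.
  apply: contrapT => nx; apply: nbd; exists (4 ^+ n * n%:R) => x Ax.
  by rewrite leNgt; apply/negP => lt; apply: nx; exists x; split; rewrite ?ltW.
have /choice[g gP] n : exists g, [/\ scalar g, forall z, g z <= N z & N (x n) <= g (x n)].
  have [|y z s t -> -> _ _ st|z ->//|g [gl gN gx]] :=
    @mazur_orlicz _ _ N [set x n] (N (x n)) sN; first by exists (x n).
    by rewrite -scalerDl st scale1r.
  by exists g; split=> //; exact: gx.
have gl n : scalar (g n) by have [] := gP n.
have gN n z : `|g n z| <= N z.
  have [_ h _] := gP n; rewrite ler_norml h andbT lerNl.
  have := h (- z); rewrite NN; have := gl n (-1) z 0; have := gl n 1 0 0.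
  by rewrite scale1r !addr0 scaleN1r; lra.
pose a n : R := 4^-1 ^+ n.
have a0 n : 0 < a n by rewrite exprn_gt0// invr_gt0.
have aS n : a n.+1 = a n / 4 by rewrite /a exprSr.
pose s n (f : E -> R) : R := if 0 <= f (x n) * g n (x n) then 1 else -1.
pose F := fix F n := if n is m.+1
  then fun z : E => F m z + s m (F m) * a m * g m z else fun=> 0.
have FS n z : F n.+1 z = F n z + s n (F n) * a n * g n z by [].
have s1 n f : `|s n f| = 1 by rewrite /s; case: ifP; rewrite ?normrN normr1.
have FSle n z : `|F n.+1 z - F n z| <= a n * N z.
  rewrite FS addrC addKr !normrM s1 mul1r (ger0_norm (ltW (a0 n))).
  by rewrite ler_wpM2l// ltW.
have Fx n : a n * N (x n) <= `|F n.+1 (x n)|.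
  have gx : g n (x n) = N (x n).
    by apply/eqP; rewrite eq_le; have [_ -> ->] := gP n.
  rewrite FS /s gx; have := mulr_ge0 (ltW (a0 n)) (N0 (x n)).
  have := N0 (x n); case: ifPn => [|/negbTE]; last first.
    move/negbT; rewrite -ltNge => h Nx aN; rewrite mulN1r mulNr.
    have F0 : F n (x n) < 0 by rewrite ltNge; apply/negP => F0; have := mulr_ge0 F0 Nx; lra.
    by rewrite ler0_norm; lra.
  move=> h; rewrite le_eqVlt => /predU1P[<-|Nx] aN.
    by rewrite !mulr0 addr0.
  have F0 : 0 <= F n (x n) by rewrite -(pmulr_lge0 _ Nx).
  by rewrite mul1r ger0_norm; lra.
have Flin n : scalar (F n).
  elim: n => [|n ih] b y z; first by rewrite /= mulr0 addr0.
  by rewrite !FS ih gl; ring.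
pose V z := [set F n z + a n *+ 2 * N z | n in setT].
(* The intervals of centre [F n z] and radius [2 a n N z] are nested, since a step moves the centre
   by at most [a n N z] and [1 + 2/4 <= 2]. *)
have nest n k z : F n z - a n *+ 2 * N z <= F (n + k)%N z - a (n + k)%N *+ 2 * N z
    /\ F (n + k)%N z + a (n + k)%N *+ 2 * N z <= F n z + a n *+ 2 * N z.
  elim: k => [|k [ih1 ih2]]; first by rewrite addn0.
  rewrite addnS; move: ih1 ih2 (FSle (n + k)%N z) (mulr_ge0 (ltW (a0 (n + k)%N)) (N0 z)).
  rewrite aS ler_distl => ih1 ih2 /andP[h1 h2] h3.
  by split; rewrite !mulr2n in ih1 ih2 *; lra.
have sep n m z : F n z - a n *+ 2 * N z <= F m z + a m *+ 2 * N z.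
  have h j : 0 <= a j *+ 2 * N z by rewrite mulr_ge0// mulrn_wge0// ltW.
  have [nm|/ltnW mn] := leqP n m.
    by have [+ _] := nest n (m - n)%N z; rewrite subnKC//; have := h m; lra.
  by have [_] := nest m (n - m)%N z; rewrite subnKC//; have := h n; lra.
(* The sum of the series, taken as the infimum of the upper ends; by [sep] it lies in every
   interval. *)
pose U z := inf (V z).
have UF n z : `|U z - F n z| <= a n *+ 2 * N z.
  rewrite ler_distl; apply/andP; split.
    apply: lb_le_inf; first by exists (F 0%N z + a 0%N *+ 2 * N z), 0%N.
    by move=> _ [m _ <-]; exact: sep.
  apply: ge_inf; last by exists n.
  by exists (F 0%N z - a 0%N *+ 2 * N z) => _ [m _ <-]; exact: sep.
have Ulin : scalar U.
  move=> b y z; apply/eqP; rewrite -subr_eq0 -normr_le0.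
  apply: (@le0_of_le_expn _ ((N (b *: y + z) + `|b| * N y + N z) *+ 2)) => n.
  rewrite -/(a n).
  have := UF n (b *: y + z); rewrite Flin => h1; have h2 := UF n y; have h3 := UF n z.
  have -> : U (b *: y + z) - (b * U y + U z) = (U (b *: y + z) - (b * F n y + F n z))
    - b * (U y - F n y) - (U z - F n z) by ring.
  apply: le_trans (ler_normB _ _) _; rewrite mulrnAr -mulrnAl !mulrDr.
  apply: lerD h3; apply: le_trans (ler_normB _ _) _; apply: lerD h1 _.
  by rewrite -mulrDr normrM mulrCA ler_wpM2l.
have [|m mP] := wbd U Ulin.
  by exists (1 *+ 2) => z; have := UF 0%N z; rewrite subr0 /a expr0.
have [n mn] : exists n : nat, m *+ 2 < n%:R.
  by exists (Num.truncn (m *+ 2)).+1; rewrite truncnS_gt.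
have [Ax Nx] := xP n.
(* At [x n] the partial sum has size at least [a n N (x n)] and the tail at most half of that, so
   [U (x n)] has size at least [n/2 > m]. *)
have := mP _ Ax; have := UF n.+1 (x n); have := Fx n.
have : n%:R <= a n * N (x n).
  by rewrite /a exprVn ler_pdivlMl ?exprn_gt0.
rewrite aS -mulr_natl.
have := ler_distD (U (x n)) (F n.+1 (x n)) 0; rewrite !subr0 (distrC _ (U _)).
rewrite mulr2n in mn; lra.
Qed.

End UniformBoundedness.

(** * Real and complex scalars *)

Section Scalars.
Context {R : realType} {k : scalars}.

Definition of_real : R -> scalar_field R k :=
  match k with
  | RealScalars => fun a => a
  | ComplexScalars => fun a => (a%:C)%C
  end.

Lemma of_realD a b : of_real (a + b) = of_real a + of_real b.
Proof. by rewrite /of_real; case: k => //=; rewrite rmorphD. Qed.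

Lemma of_realM a b : of_real (a * b) = of_real a * of_real b.
Proof. by rewrite /of_real; case: k => //=; rewrite rmorphM. Qed.

Lemma of_real1 : of_real 1 = 1.
Proof. by rewrite /of_real; case: k. Qed.

Lemma of_real0 : of_real 0 = 0.
Proof. by rewrite /of_real; case: k. Qed.

Lemma of_realB a b : of_real (a - b) = of_real a - of_real b.
Proof. by rewrite /of_real; case: k => //=; rewrite rmorphB. Qed.

Lemma of_real_le a b : (of_real a <= of_real b) = (a <= b).
Proof. by rewrite /of_real; case: k => //=; rewrite lecR. Qed.

Lemma of_real_lt a b : (of_real a < of_real b) = (a < b).
Proof. by rewrite /of_real; case: k => //=; rewrite ltcR. Qed.

Lemma of_real_norm a : `|of_real a| = of_real `|a|.
Proof. by rewrite /of_real; case: k => //=; rewrite normc_def/= expr0n addr0 sqrtr_sqr. Qed.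

Lemma scalar_Re_of_real a : scalar_Re (of_real a) = a.
Proof. by rewrite /of_real /scalar_Re; case: k. Qed.

Lemma of_real_scalar_Re (z : scalar_field R k) : 0 <= z -> of_real (scalar_Re z) = z.
Proof.
rewrite /of_real /scalar_Re; case: k z => //= -[a b].
by rewrite lecE/= => /andP[/eqP -> _].
Qed.

Lemma scalar_ReD (y z : scalar_field R k) : scalar_Re (y + z) = scalar_Re y + scalar_Re z.
Proof. by rewrite /scalar_Re; case: k y z => //= -[a b] [c d]. Qed.

Lemma scalar_ReM a (z : scalar_field R k) : scalar_Re (of_real a * z) = a * scalar_Re z.
Proof. by rewrite /of_real /scalar_Re; case: k z => //= -[b c] /=; rewrite mul0r subr0. Qed.

Lemma scalar_Re_norm (z : scalar_field R k) : of_real `|scalar_Re z| <= `|z|.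
Proof.
rewrite /of_real /scalar_Re; case: k z => //= -[a b].
rewrite normc_def/= lecR -sqrtr_sqr ler_wsqrtr// lerDl sqr_ge0//.
Qed.

End Scalars.

(** An alias of [B] that carries the real vector space structure, kept apart from the structure over
    the scalar field. *)
Definition realify (R : realType) (k : scalars)
    (B : lmodType (scalar_field R k)) : Type := B.

Section Realify.
Context {R : realType} {k : scalars}.

Section Module.
Context (B : lmodType (scalar_field R k)).

HB.instance Definition _ := GRing.Zmodule.on (realify B).

Let scale (a : R) (x : realify B) : realify B := of_real a *: (x : B).

Let scaleA a b x : scale a (scale b x) = scale (a * b) x.
Proof. by rewrite /scale of_realM scalerA. Qed.

Let scale1 : left_id 1 scale.
Proof. by move=> x; rewrite /scale of_real1 scale1r. Qed.

Let scaleDr : right_distributive scale +%R.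
Proof. by move=> a x y; rewrite /scale scalerDr. Qed.

Let scaleDl x : {morph scale^~ x : a b / a + b}.
Proof. by move=> a b; rewrite /scale of_realD scalerDl. Qed.

HB.instance Definition _ := GRing.Zmodule_isLmodule.Build R (realify B)
  scaleA scale1 scaleDr scaleDl.

Lemma realify_scaleE a (x : B) : a *: (x : realify B) = of_real a *: x.
Proof. by []. Qed.

End Module.

Section Norm.
Context {B : normedModType (scalar_field R k)}.

Lemma of_real_rnorm (x : B) : of_real (rnorm x) = `|x|.
Proof. exact: of_real_scalar_Re. Qed.

Lemma rnorm_sublinear : sublinear (@rnorm R k B : realify B -> R).
Proof.
split=> [x y|t x t0].
  by rewrite -(@of_real_le _ k) of_realD !of_real_rnorm; exact: ler_normD.
rewrite realify_scaleE /rnorm normrZ of_real_norm scalar_ReM ger0_norm//.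
Qed.

Lemma rnormN (x : B) : rnorm (- x) = rnorm x.
Proof. by rewrite /rnorm normrN. Qed.

Lemma rnorm_eq0 (x : B) : rnorm x <= 0 -> x = 0.
Proof.
by rewrite -(@of_real_le _ k) of_real_rnorm of_real0 normr_le0 => /eqP.
Qed.

(** Weights of [convex_set] are scalars between [0] and [1]; in the complex case the order forces
    them to be real. *)
Lemma convex_combinationsP (A : set B) :
  convex_set A <-> convex_combinations (A : set (realify B)).
Proof.
split=> [cA x y s t Ax Ay s0 t0 st|cA x y l /set_mem Ax /set_mem Ay].
  have s0' : 0 <= of_real s :> scalar_field R k by rewrite -of_real0 of_real_le.
  have s1' : of_real s <= 1 :> scalar_field R k by rewrite -of_real1 of_real_le; lra.
  have /set_mem := cA x y (Itv01 s0' s1') (mem_set Ax) (mem_set Ay).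
  congr A; rewrite !realify_scaleE; congr (_ *: _ + _ *: _).
  change (1 - of_real s = of_real t :> scalar_field R k).
  by rewrite -of_real1 -of_realB -st addrC addKr.
have l0 : 0 <= l%:num by []; have l1 : l%:num <= 1 by [].
have Re_l : of_real (scalar_Re l%:num) = l%:num :> scalar_field R k.
  exact: of_real_scalar_Re.
apply/mem_set; have := cA x y (scalar_Re l%:num) (1 - scalar_Re l%:num) Ax Ay.
rewrite -(@of_real_le _ k 0) -(@of_real_le _ k 0 (1 - _)) of_real0 Re_l.
have onem_l : of_real (1 - scalar_Re l%:num) = 1 - l%:num :> scalar_field R k.
  by rewrite of_realB of_real1 Re_l.
rewrite onem_l subr_ge0 addrC subrK => /(_ l0 l1 erefl).
by congr A; rewrite !realify_scaleE onem_l Re_l.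
Qed.

End Norm.
End Realify.

Lemma continuous_dual_of_bounded (K : numFieldType) (V : normedModType K)
    (f : V -> K^o) (c : K) : linear f -> (forall x, `|f x| <= c * `|x|) ->
  exists F : continuous_dual V, forall x, sval F x = f x.
Proof.
move=> lf cf.
pose f_lin := GRing.isLinear.Build _ _ _ _ f lf.
pose F : {linear V -> K^o} := HB.pack f f_lin.
suff cF : continuous F by exists (exist _ F cF).
apply: bounded_linear_continuous.
apply/ex_bound; exists `|c|.
apply/nbhs_normP; exists 1 => //= x /=; rewrite sub0r normrN => x1.
apply: le_trans (cf x) _.
rewrite -(ger0_norm (le_trans (normr_ge0 _) (cf x))) normrM normr_id.
by rewrite ler_piMr// ltW.
Qed.

(* For complex scalars, [u] is the real part of [u x - i u(i x)]. *)
Lemma continuous_dual_of_real (R : realType) (k : scalars)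
    (B : normedModType (scalar_field R k)) (u : realify B -> R) (c : R) : scalar u ->
  (forall x, `|u x| <= c * rnorm (x : B)) ->
  exists f : continuous_dual B, forall x, scalar_Re (sval f x) = u x.
Proof.
case: k B u => B u lu uc.
  have [|x|f fE] := @continuous_dual_of_bounded _ B u c; [exact: lu|exact: uc|].
  by exists f => x; rewrite fE.
have uD x y : u (x + y) = u x + u y by have := lu 1 x y; rewrite scale1r mul1r.
have uZ a x : u (a *: x) = a * u x.
  by have := lu a x 0; rewrite addr0 => ->; have := lu 1 0 0; rewrite scale1r addr0; lra.
pose f (x : B) : R[i] := (u x -i* u ('i%C *: x))%C.
have uS a b (x : B) : u ((a +i* b)%C *: x) = a * u x + b * u ('i%C *: x).
  have e : (a +i* b)%C *: x = (a%:C)%C *: x + (b%:C)%C *: ('i%C *: x).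
    rewrite scalerA -scalerDl; congr (_ *: _).
    by apply/eqP; rewrite eq_complex /=; apply/andP; split; apply/eqP; ring.
  rewrite e; have := uD (a *: (x : realify B)) (b *: (('i%C *: x : B) : realify B)).
  by rewrite !uZ.
(* The modulus of [f x] is at most the sum of those of [u x] and [u (i x)], and [i x] has the norm
   of [x]. *)
have [[a b] x y|x|F FE] := @continuous_dual_of_bounded _ B f (c + c)%:C%C.
- rewrite /f scalerDr scalerA.
  have -> : 'i%C * (a +i* b)%C = (- b +i* a)%C :> R[i].
    by apply/eqP; rewrite eq_complex /=; apply/andP; split; apply/eqP; ring.
  rewrite !uD (uS a b) (uS (- b) a); apply/eqP; rewrite eq_complex /=.
  by apply/andP; split; apply/eqP; ring.
- rewrite -of_real_rnorm normc_def /f /= -rmorphM lecR.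
  have ix : rnorm ('i%C *: x : B) = rnorm x.
    by rewrite /rnorm normrZ normc_def/= expr0n expr1n add0r sqrtr1 mul1r.
  apply: (@le_trans _ _ (`|u x| + `|u ('i%C *: x)|)); last first.
    by rewrite mulrDl lerD//; have := uc ('i%C *: x : B); rewrite ix.
  rewrite -[leRHS]ger0_norm ?addr_ge0// -sqrtr_sqr ler_wsqrtr// sqrrN.
  rewrite sqrrD !real_normK ?num_real//.
  by rewrite lerD2r lerDl mulrn_wge0// mulr_ge0.
- by exists F => x; rewrite FE.
Qed.

(** * Weakly compact sets *)

Lemma weak_continuous (K : numFieldType) (B : normedModType K) (f : continuous_dual B) :
  continuous (sval f : weak B -> K^o).
Proof.
move=> x A fA.
have /cvg_sup/(_ f) : nbhs (x : weak B) --> (x : weak B) by [].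
by apply; exact: (@initial_continuous _ _ (sval f : B -> K^o)).
Qed.

Section WeaklyCompact.
Context {R : realType} {k : scalars} {B : normedModType (scalar_field R k)}.

Lemma rnorm_ge0 (x : B) : 0 <= rnorm x.
Proof. by rewrite -(@of_real_le _ k) of_real0 of_real_rnorm. Qed.

Lemma rnormD (x y : B) : rnorm (x + y) <= rnorm x + rnorm y.
Proof. by have [+ _] := @rnorm_sublinear _ _ B; apply. Qed.

Lemma rnorm0 : rnorm (0 : B) = 0.
Proof. by rewrite /rnorm normr0 -of_real0 scalar_Re_of_real. Qed.

Lemma rnormZ c (x : B) : 0 <= c -> rnorm (of_real c *: x) = c * rnorm x.
Proof. by move=> c0; have [_ /(_ c x c0)] := @rnorm_sublinear _ _ B. Qed.

Lemma nbhs_rnormP (x : B) (A : set B) :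
  nbhs x A <-> exists2 e : R, 0 < e & forall y, rnorm (y - x) < e -> A y.
Proof.
split=> [/nbhs_normP[e /= e0 eA]|[e e0 eA]].
  exists (scalar_Re e) => [|y ye].
    by rewrite -(@of_real_lt _ k) of_real0 of_real_scalar_Re// ltW.
  apply: eA => /=; rewrite distrC -of_real_rnorm -(of_real_scalar_Re (ltW e0)).
  by rewrite of_real_lt.
apply/nbhs_normP; exists (of_real e) => /= [|y /=]; first by rewrite -of_real0 of_real_lt.
by rewrite distrC -of_real_rnorm of_real_lt => /eA.
Qed.

Lemma closed_rnormP (A : set B) : closed A <->
  forall x, (forall e : R, 0 < e -> exists2 y, A y & rnorm (y - x) < e) -> A x.
Proof.
split=> [cA x h|h x clx]; first apply: cA.
  move=> N /nbhs_rnormP[e e0 eN]; have [y Ay yx] := h e e0.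
  by exists y; split=> //; exact: eN.
apply: h => e e0; have [|y [Ay yx]] := clx [set y | rnorm (y - x) < e]; last by exists y.
by apply/nbhs_rnormP; exists e.
Qed.

(** Mazur-Orlicz for the norm on the translate [A - x], where the norm is at least some [e > 0]. The
    functional is dominated by the norm, hence is the real part of an element of the dual. *)
Lemma separation (A : set B) (x : B) : closed A -> A !=set0 ->
  convex_combinations (A : set (realify B)) -> ~ A x ->
  exists (f : continuous_dual B) (e : R), 0 < e /\
    forall y, A y -> scalar_Re (sval f x) + e <= scalar_Re (sval f y).
Proof.
move=> clA [y0 Ay0] cA nAx.
have [e e0 eP] : exists2 e : R, 0 < e & forall y, A y -> e <= rnorm (y - x).
  apply: contrapT => ne; apply: nAx; apply: (closed_rnormP A).1 => // e e0.
  apply: contrapT => ny; apply: ne; exists e => // y Ay.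
  by rewrite leNgt; apply/negP => lt; apply: ny; exists y.
have sN := @rnorm_sublinear _ _ B.
pose D : set (realify B) := [set y - x | y in A].
have [||_ [y Ay <-]|u [lu uN uD]] := @mazur_orlicz _ _ _ D e sN.
- by exists (y0 - x), y0.
- move=> _ _ s t [y Ay <-] [z Az <-] s0 t0 st.
  exists (s *: (y : realify B) + t *: (z : realify B)); first exact: cA.
  by rewrite !scalerBr addrACA -opprD -scalerDl st scale1r.
- exact: eP.
have uB a b : u (a - b) = u a - u b.
  by rewrite addrC -(scaleN1r b) lu mulN1r addrC.
have [|f fE] := @continuous_dual_of_real _ _ _ u 1 lu.
  move=> z; rewrite mul1r ler_norml uN andbT lerNl.
  by have := uN (0 - z); rewrite uB sub0r rnormN; have := uB 0 0; rewrite subrr; lra.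
exists f, e; split=> // y Ay; rewrite !fE.
have := uD (y - x); rewrite uB => /(_ (ex_intro2 _ _ y Ay erefl)); lra.
Qed.

Lemma weak_continuous_Re (f : continuous_dual B) :
  continuous (fun x : weak B => scalar_Re (sval f x)).
Proof.
move=> x A /nbhs_normP[e /= e0 eA].
apply: (@weak_continuous _ _ f x [set z | A (scalar_Re z)]).
apply/nbhs_normP; exists (of_real e) => /= [|z /=]; first by rewrite -of_real0 of_real_lt.
move=> zx; apply: eA => /=; rewrite -(@of_real_lt _ k).
apply: le_lt_trans zx; apply: le_trans (scalar_Re_norm _).
by rewrite -{1}(subrK z (sval f x)) scalar_ReD addrK.
Qed.

(** A norm-bounded real functional is weakly continuous, so its image of [V] is compact in the
    reals; uniform boundedness concludes. *)
Lemma weakly_compact_bounded (V : set B) : weakly_compact V ->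
  exists m : R, forall x, V x -> rnorm x <= m.
Proof.
move=> cV; apply: (@uniform_boundedness R (realify B)).
- exact: rnorm_sublinear.
- exact: rnormN.
move=> u lu [c uc]; have [f fE] := continuous_dual_of_real lu uc.
have : compact ((fun x : weak B => scalar_Re (sval f x)) @` V).
  by apply: continuous_compact cV; apply: continuous_subspaceT; exact: weak_continuous_Re.
move=> /compact_bounded[m [_ /(_ (m + 1))]]; rewrite ltrDl ltr01 => /(_ isT) fm.
by exists (m + 1) => x Vx; rewrite -fE; apply: fm; exists x.
Qed.

(** The filter generated by the [K m] has a weak cluster point in [V]. Were it outside some [K m],
    separation would give a weakly open half-space around it that misses [K m]. *)
Lemma weakly_compact_capn (V : set B) (K : nat -> set B) : weakly_compact V ->
  (forall m, closed (K m)) ->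
  (forall m, convex_combinations (K m : set (realify B))) ->
  (forall m, K m.+1 `<=` K m) -> (forall m, K m !=set0) -> K 0%N `<=` V ->
  exists x, forall m, K m x.
Proof.
move=> cV clK cK Kdec K0 KV.
have Kle m n : (m <= n)%N -> K n `<=` K m.
  move=> /subnK <-; elim: (n - m)%N => // j ih.
  by rewrite addSn; exact: subset_trans (Kdec _) ih.
pose F : set_system (weak B) := [set A | exists m, K m `<=` A].
have FF : ProperFilter F.
  split; first by move=> [m] Km; have [x /Km] := K0 m.
  split; first by exists 0%N.
  - move=> P Q [m Pm] [n Qn]; exists (maxn m n) => x Kx.
    by split; [apply: Pm|apply: Qn]; apply: Kle Kx; rewrite ?leq_maxl ?leq_maxr.
  - by move=> P Q PQ [m Pm]; exists m; exact: subset_trans Pm PQ.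
have [|x [Vx clx]] := cV F FF; first by exists 0%N.
exists x => m; apply: contrapT => nK.
have [f [e [e0 fe]]] := separation (clK m) (K0 m) (cK m) nK.
have [||y [Ky]] := clx (K m) [set y | scalar_Re (sval f y) < scalar_Re (sval f x) + e].
- by exists m.
- have : nbhs (scalar_Re (sval f x)) [set r | r < scalar_Re (sval f x) + e].
    by apply: open_nbhs_nbhs; split; [exact: open_lt | rewrite /= ltrDl].
  by move/(@weak_continuous_Re f x).
by have := fe y Ky; rewrite /=; lra.
Qed.

End WeaklyCompact.

(** * Strong random elements *)

Section StrongRandomElements.
Context {R : realType} {k : scalars} {B : normedModType (scalar_field R k)}.
Context {V : set B}.

Definition rdist (x y : V) : R := rnorm (set_val x - set_val y).

Lemma rdistC x y : rdist x y = rdist y x.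
Proof. by rewrite /rdist -rnormN opprB. Qed.

Lemma rdist_triangle x y z : rdist x z <= rdist x y + rdist y z.
Proof. by rewrite /rdist -(subrKA (set_val y)) rnormD. Qed.

Lemma nbhs_rdistP (x : V) (A : set V) :
  nbhs x A <-> exists2 e : R, 0 < e & forall y, rdist x y < e -> A y.
Proof.
split=> [|[e e0 eA]].
  rewrite nbhsE => -[_ [[G oG <-] Gx] GA].
  have /nbhs_rnormP[e e0 eG] : nbhs (set_val x) G by exact: open_nbhs_nbhs.
  by exists e => // y; rewrite rdistC => /eG/GA.
have cval : continuous (set_val : V -> B) by exact: initial_continuous.
have := cval x [set y | rnorm (y - set_val x) < e]; rewrite nbhs_simpl/= => h.
have {}h : nbhs x (set_val @^-1` [set y : B | rnorm (y - set_val x) < e]).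
  by apply: h; apply/nbhs_rnormP; exists e.
by apply: filterS h => y /= yx; apply: eA; rewrite rdistC.
Qed.

Context {d : measure_display} {Omega : measurableType d}.

(** The limit is within [c] of [y] iff, for each [j], the approximations eventually lie in the open
    ball of radius [c + 1/(j+1)]. *)
Lemma strong_random_element_le (X : Omega -> V) y c : strong_random_element X ->
  measurable [set w | rdist y (X w) <= c].
Proof.
move=> [S sS SX].
rewrite (_ : [set _ | _] = [set w | forall j, exists N, forall i,
    (S (N + i)%N @^-1` [set z | rdist y z < c + j.+1%:R^-1]) w]).
  apply: measurable_forall => j; apply: measurable_exists => N.
  apply: measurable_forall => i; have [+ _] := sS (N + i)%N; apply.
  rewrite openE => z /= yz; apply/nbhs_rdistP.
  exists (c + j.+1%:R^-1 - rdist y z); first by rewrite subr_gt0.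
  by move=> t /=; have := rdist_triangle y z t; move: j.+1%:R^-1 => e; lra.
have Sclose w (e : R) : 0 < e ->
    exists N, forall n, (N <= n)%N -> rdist (X w) (S n w) < e.
  move=> e0; have : \forall n \near \oo, rdist (X w) (S n w) < e.
    have : nbhs (X w) [set z | rdist (X w) z < e] by apply/nbhs_rdistP; exists e.
    by move/(SX w).
  by move=> [N _ NP]; exists N.
apply/seteqP; split=> [w /= yX j|w /= h].
  have [|N NP] := Sclose w j.+1%:R^-1; first by rewrite invr_gt0.
  exists N => i; have := NP (N + i)%N (leq_addr _ _).
  have := rdist_triangle y (X w) (S (N + i)%N w) => /=.
  by move: j.+1%:R^-1 => e; lra.
rewrite leNgt; apply/negP => /ltr_add_invr[j]; have [N NP] := h j.
move: (c + _) NP => b NP bX; move: bX; rewrite -subr_gt0 => /(Sclose w)[N' N'P].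
have := NP N'; have := N'P (N + N')%N (leq_addl _ _).
have := rdist_triangle y (S (N + N')%N w) (X w).
by rewrite (rdistC (X w)); lra.
Qed.

(** The least index among [0, ..., m] at which [u] is nearest to [X w]; ties keep the earlier
    index. *)
Fixpoint nearest_index (X : Omega -> V) (u : nat -> V) m w : nat :=
  if m is n.+1 then
    let i := nearest_index X u n w in
    if rdist (u m) (X w) < rdist (u i) (X w) then m else i
  else 0%N.

Lemma nearest_index_le X u m w : (nearest_index X u m w <= m)%N.
Proof. by elim: m => //= m ih; case: ifP => // _; exact: leqW. Qed.

Lemma nearest_indexP X u m w n : (n <= m)%N ->
  rdist (u (nearest_index X u m w)) (X w) <= rdist (u n) (X w).
Proof.
elim: m => [|m ih]; first by rewrite leqn0 => /eqP ->.
rewrite leq_eqVlt => /predU1P[->|/ih]; rewrite /=; first by case: (ltP (rdist (u m.+1) _)).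
by case: (ltP (rdist (u m.+1) _)) => // /ltW /le_trans h /h.
Qed.

Lemma measurable_nearest_index X u m j :
  (forall n, measurable_fun setT (fun w => rdist (u n) (X w))) ->
  measurable [set w | nearest_index X u m w = j].
Proof.
move=> mX; elim: m j => [|m ih] j; first exact: (measurable_prop (0%N = j)).
pose L := [set w | exists i, ([set w | nearest_index X u m w = i] `&`
  ~` [set w | 0 <= rdist (u m.+1) (X w) - rdist (u i) (X w)]) w].
have mL : measurable L.
  apply: measurable_exists => i; apply: measurableI => //.
  by apply: measurableC; apply: measurable_ge; exact: measurable_funB.
rewrite (_ : [set _ | _] = (L `&` [set _ | m.+1 = j]) `|`
    (~` L `&` [set w | nearest_index X u m w = j])).
  apply: measurableU; apply: measurableI => //; first exact: measurable_prop.
  exact: measurableC.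
have LE w : L w <-> rdist (u m.+1) (X w) < rdist (u (nearest_index X u m w)) (X w).
  split=> [[i [<-]] /negP|lt]; first by rewrite -ltNge subr_lt0.
  by exists (nearest_index X u m w); split=> //; apply/negP; rewrite -ltNge subr_lt0.
apply/seteqP; split=> w; rewrite /setU /setI /setC /= ?LE.
  by case: ifPn => [lt <-|/negP nlt <-]; [left|right].
by case: ifPn => [_ [[_ ->]|[]//]|_ [[]//|[_ ->]]].
Qed.

(** The simple elements take as value the point nearest to [X w] among [u 0, ..., u m]. *)
Lemma strong_random_element_dense (X : Omega -> V) (u : nat -> V) :
  (forall w (e : R), 0 < e -> exists n, rdist (u n) (X w) < e) ->
  (forall n c, measurable [set w | rdist (u n) (X w) <= c]) ->
  strong_random_element X.
Proof.
move=> udense mX0.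
have mX n : measurable_fun setT (fun w => rdist (u n) (X w)).
  move=> _; apply: (measurability _ (RGenOInfty.measurableE R)) => //.
  move=> _ [_ [c ->] <-]; rewrite setTI.
  rewrite (_ : _ @^-1` _ = ~` [set w | rdist (u n) (X w) <= c]).
    exact: measurableC.
  apply/seteqP; split=> w /=; rewrite in_itv/= andbT ltNge; first by move/negP.
  by move=> h; apply/negP.
exists (fun m w => u (nearest_index X u m w)) => [m|w].
  split=> [G _|].
    rewrite (_ : _ @^-1` _ = [set w | exists j,
        ([set w | nearest_index X u m w = j] `&` [set _ | G (u j)]) w]).
      apply: measurable_exists => j; apply: measurableI; last exact: measurable_prop.
      exact: measurable_nearest_index.
    apply/seteqP; split=> [w /= Gw|w /= [j [<-]]//].
    by exists (nearest_index X u m w).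
  apply: (@sub_finite_set _ _ (u @` `I_m.+1)); last exact/finite_image/finite_II.
  move=> _ [w _ <-]; exists (nearest_index X u m w) => //=.
  by rewrite ltnS nearest_index_le.
move=> A /nbhs_rdistP[e e0 eA]; have [n un] := udense w e e0.
exists n => // m /= nm; apply: eA; rewrite rdistC.
exact: le_lt_trans (nearest_indexP X u w nm) un.
Qed.

End StrongRandomElements.

(** * Separable reduction *)

(** The values of all finite terms built from [x0] by the operations; terms are encoded as trees,
    which are countable. A tree of any other shape evaluates to [x0]. *)
Lemma countable_closure (I : countType) (X : Type) (op : I -> X -> X -> X) (x0 : X) :
  exists v : nat -> X, forall i a b, exists n, v n = op i (v a) (v b).
Proof.
pose eval := fix eval (t : GenTree.tree I) : X :=
  if t is GenTree.Node _ [:: GenTree.Leaf i; t1; t2] then op i (eval t1) (eval t2)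
  else x0.
pose tree n : GenTree.tree I := odflt (GenTree.Node 0 [::]) (unpickle n).
exists (eval \o tree) => i a b.
exists (pickle (GenTree.Node 0 [:: GenTree.Leaf i; tree a; tree b])).
by rewrite /= {1}/tree pickleK.
Qed.

Section RandomFixedPoint.
Context {R : realType} {k : scalars} {B : normedModType (scalar_field R k)}.
Context {V : set B} (V_weakly_compact : weakly_compact V) (V_normal : normal_structure V).
Context {d : measure_display} {Omega : measurableType d} (P : probability Omega R).
Context (T : Omega -> V -> V) (hT : strong_random_nonexpansive_operator T).

Let V_bounded : exists m : R, forall x : V, rnorm (set_val x) <= m.
Proof.
have [m mP] := weakly_compact_bounded V_weakly_compact.
by exists m => -[x /= xV]; apply: mP; exact: set_mem.
Qed.

Let rdist_bounded : exists m : R, forall x y : V, rdist x y <= m.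
Proof.
have [m mP] := V_bounded; exists (m + m) => x y.
by apply: le_trans (rnormD _ _) _; rewrite rnormN lerD.
Qed.

Let T_nonexp w x y : rdist (T w x) (T w y) <= rdist x y.
Proof.
have [_ /(_ w x y)] := hT.
by rewrite -!of_real_rnorm of_real_le.
Qed.

Let V_convex (x y : V) (s t : R) : 0 <= s -> 0 <= t -> s + t = 1 ->
  exists z : V, set_val z = of_real s *: set_val x + of_real t *: set_val y.
Proof.
move=> s0 t0 st; have [_ _ /convex_combinationsP cV _] := V_normal.
case: x y => [x xV] [y yV].
have := cV x y s t (set_mem xV) (set_mem yV) s0 t0 st.
move=> /mem_set zV.
by exists (exist (fun z => z \in V) (of_real s *: x + of_real t *: y) zV).
Qed.

Let adherent (v : nat -> V) : set V :=
  [set x | forall e : R, 0 < e -> exists n, rdist x (v n) < e].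

(** Closes a point of [V] under two countable families: enumerations [e x] that approximate all
    values [T w x], and convex combinations with rational weights. *)
Lemma separable_invariant_subset : exists v : nat -> V,
  (forall w n, adherent v (T w (v n))) /\
  forall n m (z : V) (s t : R), 0 <= s -> 0 <= t -> s + t = 1 ->
    set_val z = of_real s *: set_val (v n) + of_real t *: set_val (v m) ->
    adherent v z.
Proof.
have [[x0 x0V] _ _ _] := V_normal.
have /choice[e eP] (x : V) : exists e : nat -> V,
    forall w (eps : R), 0 < eps -> exists n, rdist (T w x) (e n) < eps.
  have [+ _] := hT => /(_ x)[S sS ST].
  have /choice[s sP] n : exists s : seq V, range (S n) = [set` s].
    by have [_ /finite_seqP] := sS n.
  (* Enumerates the union of the finite ranges of the simple elements converging to [T ^~ x]. *)
  exists (fun j => let: (n, i) := odflt (0%N, 0%N) (unpickle j) in nth x (s n) i).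
  move=> w eps eps0.
  have : nbhs (T w x) [set z | rdist (T w x) z < eps] by apply/nbhs_rdistP; exists eps.
  move=> /(ST w)[N _ /(_ N (leqnn _))/= SN].
  have sSN : S N w \in s N.
    by have : range (S N) (S N w) by []; rewrite sP.
  by exists (pickle (N, index (S N w) (s N))); rewrite pickleK/= nth_index.
have /choice[comb combP] (q : R * (V * V)) : exists z : V, 0 <= q.1 -> q.1 <= 1 ->
    set_val z = of_real q.1 *: set_val q.2.1 + of_real (1 - q.1) *: set_val q.2.2.
  case: q => q [x y] /=; have [q0|] := boolP (0 <= q); last by exists x.
  have [q1|] := boolP (q <= 1); last by exists x.
  have [||z zE] := V_convex x y q0 (t := 1 - q); [by lra|by lra|by exists z].
pose op (i : nat + nat * nat) (x y : V) := match i with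
  | inl j => e x j
  | inr (n, j) => comb (j%:R / n.+1%:R, (x, y))
  end.
have [v vP] := countable_closure op (exist _ x0 (mem_set x0V)).
exists v; split=> [w n eps eps0|n m z s t s0 t0 st zE eps eps0].
  have [j ej] := eP (v n) w eps eps0.
  by have [i vi] := vP (inl j) n n; exists i; rewrite vi.
have [c cP] := rdist_bounded.
have c0 : 0 < `|c| + 1 by rewrite ltr_wpDl.
have [N] := ltr_add_invr (divr_gt0 eps0 c0); rewrite add0r => Neps.
(* Rounding [s] down to a multiple of [1/(N+1)] moves the combination by at most [1/(N+1)] times the
   distance of [v n] and [v m]. *)
pose j := Num.truncn (s * N.+1%:R); pose q : R := j%:R / N.+1%:R.
have /truncn_itv/andP[js sj] : 0 <= s * N.+1%:R by rewrite mulr_ge0.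
have [i vi] := vP (inr (N, j)) n m; exists i.
have q0 : 0 <= q by rewrite divr_ge0.
have qs : q <= s by rewrite ler_pdivrMr.
have sq : s - q < N.+1%:R^-1.
  by rewrite ltrBlDr addrC /q -[X in _ + X]mul1r -mulrDl ltr_pdivlMr// natr1.
have q1 : q <= 1 by lra.
have := combP (q, (v n, v m)) q0 q1 => /= cE.
rewrite /rdist vi /op -/q cE zE.
have -> : t = 1 - s by lra.
have -> : of_real s *: set_val (v n) + of_real (1 - s) *: set_val (v m) -
    (of_real q *: set_val (v n) + of_real (1 - q) *: set_val (v m)) =
    of_real (s - q) *: (set_val (v n) - set_val (v m)).
  rewrite !of_realB of_real1 scalerBr !scalerBl !scale1r.
  rewrite opprD addrACA; congr (_ + _).
  by rewrite !opprB addrC subrKA.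
rewrite rnormZ ?subr_ge0// -/(rdist (v n) (v m)).
apply: (@le_lt_trans _ _ (N.+1%:R^-1 * (`|c| + 1))).
  apply: ler_pM; rewrite ?subr_ge0 ?rnorm_ge0 ?(ltW sq)//.
  by apply: (le_trans (cP _ _)); have := ler_norm c; lra.
by rewrite -ltr_pdivlMr.
Qed.

(** * The fixed point on the separable invariant subset *)

Section InvariantSubset.
Context (v : nat -> V) (T_v : forall w n, adherent v (T w (v n))).
Hypothesis v_convex : forall n m (z : V) (s t : R), 0 <= s -> 0 <= t -> s + t = 1 ->
  set_val z = of_real s *: set_val (v n) + of_real t *: set_val (v m) ->
  adherent v z.

Let adherent_adherent x :
  (forall e : R, 0 < e -> exists2 y, adherent v y & rdist x y < e) ->
  adherent v x.
Proof.
move=> h e e0; have e2 : 0 < e / 2 by rewrite divr_gt0.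
have [y yv xy] := h _ e2; have [n yn] := yv _ e2; exists n.
by have := rdist_triangle x y (v n); lra.
Qed.

Let T_adherent w x : adherent v x -> adherent v (T w x).
Proof.
move=> xv; apply: adherent_adherent => e e0; have [n xn] := xv e e0.
by exists (T w (v n)) => //; exact: le_lt_trans (T_nonexp _ _ _) xn.
Qed.

Let closed_adherent : closed (set_val @` adherent v).
Proof.
apply/closed_rnormP => b h.
have [_ clV _ _] := V_normal.
have Vb : V b.
  apply: (closed_rnormP V).1 => // e e0; have [_ [y _ <-] yb] := h e e0.
  by exists (set_val y) => //; case: y {yb} => y yV; exact: set_mem.
exists (exist (fun z => z \in V) b (mem_set Vb)) => //.
apply: adherent_adherent => e e0; have [_ [y yv <-] yb] := h e e0.
by exists y => //; rewrite rdistC.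
Qed.

Let convex_adherent : convex_combinations (set_val @` adherent v : set (realify B)).
Proof.
move=> _ _ s t [x xv <-] [y yv <-] s0 t0 st.
have [z zE] := V_convex x y s0 t0 st; exists z => //.
apply: adherent_adherent => e e0; have [n xn] := xv e e0; have [m ym] := yv e e0.
have [z' zE'] := V_convex (v n) (v m) s0 t0 st; exists z'; first exact: v_convex zE'.
rewrite /rdist zE zE' opprD addrACA -!scalerBr.
apply: le_lt_trans (rnormD _ _) _; rewrite !rnormZ//.
rewrite /rdist in xn ym; rewrite -[ltRHS]mul1r -st mulrDl.
(* The strict inequality must come from a summand with nonzero weight; if [s = 0] then [t = 1]. *)
have [s0'|s_neq0] := eqVneq s 0; last first.
  by apply: ltr_leD; [rewrite ltr_pM2l// lt0r s_neq0|rewrite ler_wpM2l// ltW].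
by rewrite s0' !mul0r !add0r ltr_pM2l//; lra.
Qed.

Let M := set_type (adherent v).
Let emb (x : M) : B := set_val (set_val x).
Let dist (x y : M) : R := rdist (set_val x) (set_val y).
Let adm (K : set M) : Prop :=
  closed (emb @` K) /\ convex_combinations (emb @` K : set (realify B)).

Let emb_inj : injective emb.
Proof. by move=> x y /val_inj/val_inj. Qed.

Let adm_preimage (C : set B) : closed C -> convex_combinations (C : set (realify B)) ->
  adm (emb @^-1` C).
Proof.
move=> clC cC.
rewrite /adm (_ : emb @` _ = (set_val @` adherent v) `&` C).
  split; first exact: closedI.
  move=> x y s t [Wx Cx] [Wy Cy] s0 t0 st; split; last exact: cC.
  exact: convex_adherent.
apply/seteqP; split=> [_ [x Cx <-]|_ [[x vx <-] Cx]].
  by split=> //; exists (set_val x) => //; case: x {Cx} => x xW; exact: set_mem.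
by exists (exist (fun z => z \in adherent v) x (mem_set vx)).
Qed.

Let adm_bigcap (J : Type) (K : J -> set M) :
  (forall i, adm (K i)) -> adm [set x | forall i, K i x].
Proof.
move=> aK.
rewrite (_ : [set _ | _] = emb @^-1` (\bigcap_i (emb @` K i))).
  apply: adm_preimage; first by apply: closed_bigI => i _; have [] := aK i.
  move=> x y s t Kx Ky s0 t0 st i _; have [_ cK] := aK i.
  by apply: cK => //; [exact: Kx|exact: Ky].
apply/seteqP; split=> [x Kx i _|x Kx i]; first by exists x.
by have [y Ky /emb_inj <-] := Kx i I.
Qed.

Let adm_cball (x : M) (r : R) : adm [set y | dist x y <= r].
Proof.
apply: (@adm_preimage [set y | rnorm (emb x - y) <= r]).
  apply/closed_rnormP => y h /=; apply/ler_addgt0Pl => e e0.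
  have [z /= zr zy] := h e e0; rewrite -(subrKA z).
  by apply: le_trans (rnormD _ _) _; lra.
move=> y z s t /= yr zr s0 t0 st.
have -> : emb x - (s *: (y : realify B) + t *: (z : realify B) : B) =
    of_real s *: (emb x - y) + of_real t *: (emb x - z).
  rewrite !scalerBr addrACA -scalerDl -of_realD st of_real1 scale1r -opprD //.
apply: le_trans (rnormD _ _) _; rewrite !rnormZ// -[leRHS]mul1r -st mulrDl.
by apply: lerD; rewrite ler_wpM2l.
Qed.

Let adm_compact (K : nat -> set M) : (forall m, adm (K m)) ->
  (forall m, K m.+1 `<=` K m) -> (forall m, K m !=set0) -> exists x, forall m, K m x.
Proof.
move=> aK Kdec K0.
have [m|m|m|m||b Kb] :=
    @weakly_compact_capn _ _ _ V (fun m => emb @` K m) V_weakly_compact.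
- by have [] := aK m.
- by have [] := aK m.
- exact: image_subset.
- by have [x Kx] := K0 m; exists (emb x), x.
- by move=> _ [x _ <-]; rewrite /emb; case: (set_val x) => y yV; exact: set_mem.
have [x _ xb] := Kb 0%N; exists x => m; have [y Ky] := Kb m.
by rewrite -xb => /emb_inj <-.
Qed.

(** Here [c] is the radius about the point given by normal structure; if no pair were further apart
    than [c], the diameter would not exceed it. *)
Let adm_normal (K : set M) (x y : M) : adm K -> K x -> K y -> x <> y ->
  exists c, (exists2 h, K h & forall z, K z -> dist h z <= c) /\
    exists a b, [/\ K a, K b & c < dist a b].
Proof.
move=> [clK cK] Kx Ky xy; have [_ _ _ nV] := V_normal.
have [c0 c0P] := rdist_bounded; have [c1 c1P] := V_bounded.
pose E := [set rnorm (h1 - h2) | h1 in emb @` K & h2 in emb @` K].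
have EP a b : K a -> K b -> E (dist a b).
  by move=> Ka Kb; exists (emb a); [exists a|exists (emb b) => //; exists b].
have E_ub : has_ubound E.
  by exists c0 => _ [_ [a _ <-] [_ [b _ <-] <-]]; exact: c0P.
have [|||||_ [h Kh <-] hd] := nV (emb @` K).
- by move=> _ [z _ <-]; rewrite /emb; case: (set_val z) => z' z'V; exact: set_mem.
- exists (of_real c1); split; first by rewrite realE -of_real0 !of_real_le le_total.
  move=> r cr _ [z _ <-]; apply: le_trans _ (ltW cr).
  by rewrite -of_real_rnorm of_real_le; exact: c1P.
- exact: clK.
- by apply/convex_combinationsP.
- apply: lt_le_trans (ub_le_sup E_ub (EP x y Kx Ky)).
  rewrite ltNge; apply/negP => /rnorm_eq0/eqP; rewrite subr_eq0 => /eqP.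
  by move/val_inj/val_inj.
exists (radius_at (emb @` K) (emb h)); split.
  exists h => // z Kz; apply: ub_le_sup; last by exists (emb z) => //; exists z.
  by exists c0 => _ [_ [b _ <-] <-]; exact: c0P.
apply: contrapT => nab; move: hd; apply/negP; rewrite -leNgt.
apply: ge_sup; first by exists (dist x y); exact: EP.
move=> _ [_ [a Ka <-] [_ [b Kb <-] <-]]; rewrite leNgt; apply/negP => lt.
by apply: nab; exists a, b.
Qed.

Lemma random_fixed_point_adherent : exists x0 : Omega -> V,
  strong_random_element x0 /\ {ae P, forall w, T w (x0 w) = x0 w}.
Proof.
have v_adherent n : v n \in adherent v.
  by apply/mem_set => e e0; exists n; rewrite /rdist subrr rnorm0.
pose u n : M := exist _ (v n) (v_adherent n).
pose TM w (x : M) : M :=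
  exist _ (T w (set_val x)) (mem_set (T_adherent w (set_mem (valP x)))).
have [c cP] := rdist_bounded.
have distxx (x : M) : dist x x = 0 by rewrite /dist /rdist subrr rnorm0.
have dist_eq0 (x y : M) : dist x y <= 0 -> x = y.
  by move=> /rnorm_eq0/eqP; rewrite subr_eq0 => /eqP/val_inj/val_inj.
have dist_bnd (x y : M) : dist x y <= c by exact: cP.
have u_dense (x : M) (e : R) : 0 < e -> exists n, dist x (u n) < e.
  exact: (set_mem (valP x)).
have TM_nonexp w (x y : M) : dist (TM w x) (TM w y) <= dist x y by exact: T_nonexp.
have TM_meas (x y : M) r : measurable [set w | dist y (TM w x) <= r].
  by apply: (@strong_random_element_le _ _ _ _ _ _ (T^~ (set_val x))); have [] := hT.
have [x0 [mx0 [N [mN PN NP]]]] := random_kirk_metric distxx dist_eq0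
  (fun x y => rdistC _ _) (fun x y z => rdist_triangle _ _ _) dist_bnd u_dense
  adm_cball adm_bigcap adm_compact P TM_nonexp TM_meas adm_normal.
exists (fun w => set_val (x0 w)); split.
  apply: (strong_random_element_dense (u := v)) => [w e e0|n r].
    by have [n] := u_dense (x0 w) e e0; exists n; rewrite rdistC.
  exact: (mx0 (u n) r).
exists N; split=> // w /=; apply: contra_notP => /NP h.
exact: (congr1 set_val h).
Qed.

End InvariantSubset.

Lemma random_fixed_point : exists x0 : Omega -> V,
  strong_random_element x0 /\ {ae P, forall w, T w (x0 w) = x0 w}.
Proof.
by have [v [Tv cv]] := separable_invariant_subset; exact: random_fixed_point_adherent Tv cv.
Qed.

End RandomFixedPoint.

Theorem theorem3p2 (R : realType) (k : scalars)
    (d : measure_display) (Omega : measurableType d) (P : probability Omega R)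
    (B : completeNormedModType (scalar_field R k)) (V : set B)
    (V_weakly_compact : weakly_compact V) (V_convex : convex_set V)
    (V_normal : normal_structure V)
    (T : Omega -> V -> V) (hT : strong_random_nonexpansive_operator T) :
  exists x0 : Omega -> V,
    strong_random_element x0 /\ {ae P, forall w, T w (x0 w) = x0 w}.
Proof. exact: random_fixed_point. Qed.
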